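(* Let $(E\to M,g)$ be a pseudo-Euclidean vector bundle, $\rho:E\to TM$ a vector bundle morphism, and $\nabla$ a metric connection on $(E,g)$. 1) The formula $$[e_1,e_2]_0=\nabla_{\rho e_1}e_2-\nabla_{\rho e_2}e_1-\gamma(e_1,e_2),\qquad e_1,e_2\in\Gamma E,$$ where $\gamma(e_1,e_2)\in\Gamma E$ is defined by $$g(\gamma(e_1,e_2),e)=\tfrac12\left[g(e_1,\nabla_{\rho e}e_2)-g(e_2,\nabla_{\rho e}e_1)\right]\qquad\forall e\in\Gamma E,$$ defines a skew-symmetric bracket on $\Gamma E$ that satisfies property (v): for all $e,e_1,e_2\in\Gamma E$, $$(\rho e)(g(e_1,e_2))=g([e,e_1]+\partial g(e,e_1),e_2)+g(e_1,[e,e_2]+\partial g(e,e_2)).$$ 2) The most general (skew-symmetric) bracket on $\Gamma E$ that satisfies property (v) is given by $$[e_1,e_2]=[e_1,e_2]_0-\beta(e_1,e_2),$$ where $\beta\in\Gamma(\wedge^2E^*\otimes E)$ and $B(e_1,e_2,e_3)=g(\beta(e_1,e_2),e_3)$ is totally skew-symmetric, i.e., $B\in\Gamma\wedge^3E^*$. 3) The bracket $[e_1,e_2]=[e_1,e_2]_0-\beta(e_1,e_2)$ of part 2) also satisfies property (i): $\rho[e_1,e_2]=[\rho e_1,\rho e_2]$ for all $e_1,e_2\in\Gamma E$ (on the right, the Lie bracket of vector fields), if and only if the following two equalities hold: $$\rho\circ\partial=0,\qquad \rho(\beta(e_1,e_2))=T_{(\nabla,\rho)}(e_1,e_2)\quad\forall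 e_1,e_2\in\Gamma E,$$ where $T_{(\nabla,\rho)}$ is the $\rho$-torsion of $\nabla$. In particular, if $(E,g,\rho)$ has a metric connection $\nabla$ with zero $\rho$-torsion, the bracket $[\,,\,]_0$ of part 1) satisfies property (i).
   Context: Everything is $C^\infty$; $\Gamma$ denotes the space of global cross sections; brackets on $\Gamma E$ are $\mathbb{R}$-bilinear. A pseudo-Euclidean vector bundle $(E\to M,g)$ is a real vector bundle with a symmetric, non-degenerate (possibly indefinite) inner product $g$ on its fibers. For a morphism $\rho:E\to TM$, the morphism $\partial:T^*M\to E$ is $\partial=\frac12\sharp_g\circ{}^t\rho$, where ${}^t\rho$ is the transpose and $\sharp_g:E^*\to E$ is the isomorphism induced by $g$; for $f\in C^\infty(M)$, $\partial f=\partial(df)$, i.e. $g(\partial f,e)=\frac12(\rho e)f$ for all $e\in\Gamma E$. A connection $\nabla$ on $E$ is metric if $X(g(e_1,e_2))=g(\nabla_Xe_1,e_2)+g(e_1,\nabla_Xe_2)$ for all $X\in\Gamma TM$, $e_1,e_2\in\Gamma E$. The $\rho$-torsion $T_{(\nabla,\rho)}\in\Gamma(\wedge^2E^*\otimes TM)$ of $\nabla$ is $$T_{(\nabla,\rho)}(e_1,e_2)=\rho(\nabla_{\rho e_1}e_2-\nabla_{\rho e_2}e_1)-[\rho e_1,\rho e_2].$$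
   Formalization: In the final ''In particular'' sentence of part 3, the condition ρ∘∂ = 0 is added as a hypothesis; without it the sentence fails, e.g. for E = TM, ρ = id and the Levi-Civita connection of a Riemannian metric. *)

(* Defs.v *)
From HB Require Import structures.
From mathcomp Require Import all_boot all_order all_algebra.
From mathcomp Require Import all_classical all_reals all_analysis.

Set Implicit Arguments.
Unset Strict Implicit.
Unset Printing Implicit Defensive.

Import Order.TTheory GRing.Theory Num.Theory.
Import numFieldNormedType.Exports.

Local Open Scope classical_set_scope.
Local Open Scope ring_scope.

Section SmoothOn.
Context {R : realType} {V W : normedModType R}.

(* C^k on a set U that is meant to be open. *)
Fixpoint Ck (k : nat) (U : set V) (f : V -> W) : Prop :=
  match k with
  | 0 => forall x, U x -> {for x, continuous f}
  | k'.+1 => (forall x, U x -> differentiable f x) /\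
             (forall v, Ck k' U ('D_v f))
  end.

Definition smooth_on (U : set V) (f : V -> W) := forall k, Ck k U f.

End SmoothOn.

Section Calculus.
Context {R : realType}.
Implicit Types V W : normedModType R.

Lemma Ck_sub V W k (U U' : set V) (f : V -> W) : U' `<=` U -> Ck k U f -> Ck k U' f.
Proof.
move=> sU; elim: k f => [|k IH] f /=; first by move=> h x /sU /h.
by case=> h1 h2; split=> [x /sU /h1|v]; [|exact: IH].
Qed.

Lemma near_eq_diff V W (f g : V -> W) x : (\forall y \near x, f y = g y) ->
  differentiable f x -> differentiable g x /\ 'd g x = 'd f x :> (V -> W).
Proof.
move=> fg df.
have fgx : f x = g x by exact: nbhs_singleton fg.
have /eqaddoP fE := diff_locally df.
have gE : g \o shift x = cst (g x) + 'd f x +o_ 0 id.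
  apply/eqaddoP => _/posnumP[e]; near=> h; rewrite !fctE /=.
  have -> : g (h + x) = f (h + x).
    apply/esym; near: h.
    by move: fg; rewrite (near_shift 0); apply: filterS => k /=; rewrite subr0.
  rewrite -fgx; near: h; exact: fE.
have cdf : continuous ('d f x) by exact: diff_continuous.
have dg := diff_unique cdf gE.
by split=> //; apply/diff_locallyP; rewrite dg.
Unshelve. all: by end_near. Qed.

Lemma Ck_ext V W k (U : set V) (f g : V -> W) : open U ->
  (forall x, U x -> f x = g x) -> Ck k U f -> Ck k U g.
Proof.
move=> oU; have nfg (f' g' : V -> W) x : U x -> (forall x, U x -> f' x = g' x) ->
    \forall y \near x, f' y = g' y.
  by move=> Ux fg; near=> y; apply: fg; near: y; exact: open_nbhs_nbhs.
elim: k f g => [|k IH] f g fg /=.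
  move=> h x Ux; rewrite /prop_for /continuous_at -(fg x Ux).
  apply: cvg_trans (h x Ux); apply: near_eq_cvg; exact: nfg.
case=> h1 h2; split=> [x Ux|v].
  by apply: (proj1 (near_eq_diff _ (h1 x Ux))); exact: nfg.
apply: IH (h2 v) => x Ux; apply: near_eq_derive.
exact: nfg.
Unshelve. all: by end_near. Qed.

Lemma Ck_glue V W k (U : set V) (f : V -> W) :
  (forall x, U x -> exists2 U' : set V, U' x & Ck k U' f) -> Ck k U f.
Proof.
elim: k f => [|k IH] f h /=; first by move=> x /h [U' U'x hU']; exact: hU'.
split=> [x /h [U' U'x [hU' _]]|v]; first exact: hU'.
by apply: IH => x /h [U' U'x [_ d]]; exists U'; last exact: d.
Qed.

Lemma Ck_continuous V W k (U : set V) (f : V -> W) x :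
  Ck k U f -> U x -> {for x, continuous f}.
Proof.
by case: k => [|k]; [exact|move=> [h _] /h; exact: differentiable_continuous].
Qed.

Lemma Ck_pred V W k (U : set V) (f : V -> W) : Ck k.+1 U f -> Ck k U f.
Proof.
elim: k f => [|k IH] f; first by move=> h x; exact: Ck_continuous h.
by move=> [h1 h2]; split=> // v; exact/IH/h2.
Qed.

Lemma Ck_cst V W k (U : set V) (w : W) : Ck k U (cst w).
Proof.
elim: k w => [|k IH] w; first by move=> x _; exact: cst_continuous.
split=> [x _|v]; first exact: differentiable_cst.
by rewrite (_ : 'D_v _ = cst 0) //; apply/funext => x; rewrite derive_cst.
Qed.

Lemma CkD V W k (U : set V) (f g : V -> W) : open U ->
  Ck k U f -> Ck k U g -> Ck k U (fun x => f x + g x).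
Proof.
move=> oU; elim: k f g => [|k IH] f g.
  by move=> hf hg x Ux; apply: cvgD; [exact: hf|exact: hg].
move=> [f1 f2] [g1 g2]; split=> [x Ux|v].
  by apply: differentiableD; [exact: f1|exact: g1].
apply: Ck_ext (IH _ _ (f2 v) (g2 v)) => // x Ux /=; apply/esym.
by apply: deriveD; apply: diff_derivable; [exact: f1|exact: g1].
Qed.

Lemma Ck_sum V W k (U : set V) (I : Type) (r : seq I) (P : pred I)
    (f : I -> V -> W) : open U ->
  (forall i, Ck k U (f i)) -> Ck k U (fun x => \sum_(i <- r | P i) f i x).
Proof.
move=> oU h; elim: r => [|i r IH].
  by apply: (Ck_ext oU _ (Ck_cst _ _ 0)) => x _; rewrite big_nil.
case Pi: (P i).
  by apply: (Ck_ext oU _ (CkD oU (h i) IH)) => x _; rewrite big_cons Pi.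
by apply: (Ck_ext oU _ IH) => x _; rewrite big_cons Pi.
Qed.

Lemma scaler_is_bilinear W :
  bilinear_for (GRing.Scale.Law.clone _ _ *:%R _)
    (GRing.Scale.Law.clone _ _ *:%R _) (@GRing.scale R W : R -> W -> W).
Proof.
split=> [w|a] b x y /=; first by rewrite scalerDl scalerA.
by rewrite scalerDr !scalerA mulrC.
Qed.
HB.instance Definition _ W := bilinear_isBilinear.Build R R W W _ _
  (@GRing.scale R W : R -> W -> W) (@scaler_is_bilinear W).

Lemma diff_scale V W (k : V -> R) (f : V -> W) x :
  differentiable k x -> differentiable f x ->
  differentiable (fun y => k y *: f y) x /\
  forall v, 'D_v (fun y => k y *: f y) x = 'D_v k x *: f x + k x *: 'D_v f x.
Proof.
move=> dk df.
pose sc : {bilinear R -> W -> W} := @GRing.scale R W : R -> W -> W.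
have csc : continuous (fun p : R * W => sc p.1 p.2).
  by move=> p; exact: scale_continuous.
have dsc p : differentiable (fun p : R * W => sc p.1 p.2) p.
  exact: differentiable_bilin.
have dp := differentiable_pair dk df.
have dc : differentiable ((fun p => sc p.1 p.2) \o (fun y => (k y, f y))) x.
  exact: differentiable_comp.
split=> [//|v]; rewrite (deriveE v dc) diff_comp // /= diff_bilin //=.
by rewrite diff_pair //= !deriveE // addrC.
Qed.

Lemma CkZ V W k (U : set V) (a : V -> R) (f : V -> W) : open U ->
  Ck k U a -> Ck k U f -> Ck k U (fun x => a x *: f x).
Proof.
move=> oU; elim: k a f => [|k IH] a f.
  by move=> ha hf x Ux; apply: cvgZ; [exact: ha|exact: hf].
move=> [a1 a2] [f1 f2]; split=> [x Ux|v].
  exact: (proj1 (diff_scale (a1 x Ux) (f1 x Ux))).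
have h1 := IH _ _ (a2 v) (Ck_pred (conj f1 f2)).
have h2 := IH _ _ (Ck_pred (conj a1 a2)) (f2 v).
apply: (Ck_ext oU _ (CkD oU h1 h2)) => x Ux /=; apply/esym.
exact: (proj2 (diff_scale (a1 x Ux) (f1 x Ux))).
Qed.

Lemma Ck_lin V W W' k (U : set V) (f : V -> W) (l : {linear W -> W'}) : open U ->
  continuous l -> Ck k U f -> Ck k U (fun x => l (f x)).
Proof.
move=> oU cl; elim: k f => [|k IH] f.
  by move=> hf x Ux; apply: (@continuous_comp _ _ _ f l); [exact: hf|exact: cl].
have dl y : differentiable l y by exact: linear_differentiable.
move=> [f1 f2]; split=> [x Ux|v].
  by apply: (@differentiable_comp _ _ _ _ f l) => //; exact: f1.
apply: (Ck_ext oU _ (IH _ (f2 v))) => x Ux.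
have fx := f1 x Ux.
rewrite [RHS]deriveE; last exact: (@differentiable_comp _ _ _ _ f l).
by rewrite deriveE // (@diff_comp _ _ _ _ f l) //= diff_lin.
Qed.

Lemma Ck_coord V k n (U : set V) (f : V -> 'rV[R]_n) i : open U ->
  Ck k U f -> Ck k U (fun x => f x 0 i).
Proof.
move=> oU; have @l : {linear 'rV[R]_n -> R}.
  by exists (fun N : 'rV[R]_n => N 0 i); do 2![eexists]; do ?[constructor];
     rewrite ?mxE// => ? *; rewrite ?mxE//; move=> ?; rewrite !mxE.
rewrite (_ : (fun x => f x 0 i) = (fun x => l (f x))) //.
by apply: Ck_lin => //; exact: coord_continuous.
Qed.

Lemma Ck_comp V W m k (U : set V) (U' : set 'rV[R]_m) (f : V -> 'rV[R]_m)
    (g : 'rV[R]_m -> W) : open U -> (forall x, U x -> U' (f x)) ->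
  Ck k U f -> Ck k U' g -> Ck k U (g \o f).
Proof.
move=> oU sU; elim: k f g sU => [|k IH] f g sU.
  move=> hf hg x Ux; apply: continuous_comp; first exact: hf.
  exact/hg/sU.
move=> [f1 f2] [g1 g2]; split=> [x Ux|v].
  by apply: differentiable_comp; [exact: f1|exact/g1/sU].
have h i : Ck k U (fun x => ('D_v f x) 0 i *: 'D_(delta_mx 0 i) g (f x)).
  apply: CkZ => //; first exact: (Ck_coord _ oU (f2 v)).
  exact: (IH _ _ sU (Ck_pred (conj f1 f2)) (g2 _)).
apply: (Ck_ext oU _ (Ck_sum _ xpredT oU h)) => x Ux.
have fx := f1 x Ux; have gx := g1 _ (sU x Ux).
rewrite [RHS]deriveE; last exact: differentiable_comp.
rewrite diff_comp //= -(deriveE v fx).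
rewrite [in RHS](row_sum_delta ('D_v f x)) linear_sum; apply: eq_bigr => i _ /=.
by rewrite linearZ /= -(deriveE _ gx).
Qed.

End Calculus.

Record chart (R : realType) (n : nat) (M : topologicalType) := Chart {
  cdom : set M;
  ccod : set 'rV[R]_n;
  cmap : M -> 'rV[R]_n;
  cinv : 'rV[R]_n -> M;
  cdom_open : open cdom;
  ccod_open : open ccod;
  cmap_cod : forall x, cdom x -> ccod (cmap x);
  cinv_dom : forall y, ccod y -> cdom (cinv y);
  cmapK : forall x, cdom x -> cinv (cmap x) = x;
  cinvK : forall y, ccod y -> cmap (cinv y) = y;
  cmap_continuous : forall x, cdom x -> {for x, continuous cmap};
  cinv_continuous : forall y, ccod y -> {for y, continuous cinv} }.

Record manifold (R : realType) (n : nat) := Manifold {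
  mpoint :> topologicalType;
  atlas : Type;
  mchart : atlas -> chart R n mpoint;
  manifold_hausdorff : hausdorff_space mpoint;
  manifold_second_countable : @second_countable mpoint;
  atlas_cover : forall x, exists i, cdom (mchart i) x;
  atlas_smooth : forall i j,
    smooth_on (ccod (mchart i) `&` cinv (mchart i) @^-1` cdom (mchart j))
              (cmap (mchart j) \o cinv (mchart i)) }.

Arguments mchart {R n m} _ : rename.

Section SmoothFunctions.
Context {R : realType} {n : nat} (M : manifold R n).
Implicit Types (W : normedModType R) (U : set M) (i j l : atlas M) (x : M).

(* An arbitrary but fixed chart around each point, used to give the tangent
   space at x the concrete carrier R^n. *)
Definition chart_at x : atlas M := projT1 (cid (atlas_cover x)).

Lemma chart_atP x : cdom (mchart (chart_at x)) x.
Proof. exact: projT2 (cid (atlas_cover x)). Qed.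

Definition msmooth W U (f : M -> W) : Prop :=
  forall i, smooth_on (ccod (mchart i) `&` cinv (mchart i) @^-1` U) (f \o cinv (mchart i)).

Lemma chart_preimage_open i U : open U ->
  open (ccod (mchart i) `&` cinv (mchart i) @^-1` U).
Proof.
move=> oU; rewrite openE => y [cy Uy]; apply: filterI.
  by apply: open_nbhs_nbhs; split => //; exact: ccod_open.
have := cinv_continuous cy; apply.
exact: open_nbhs_nbhs.
Qed.

Lemma msmooth_sub W U U' (f : M -> W) : U' `<=` U -> msmooth U f -> msmooth U' f.
Proof.
move=> sU h i k; apply: Ck_sub (h i k) => y [cy U'y].
by split=> //; exact: sU.
Qed.

Lemma msmooth_ext W U (f g : M -> W) : open U -> (forall x, U x -> f x = g x) ->
  msmooth U f -> msmooth U g.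
Proof.
move=> oU fg h i k; apply: Ck_ext (h i k); first exact: chart_preimage_open.
by move=> y [_ Uy] /=; exact: fg.
Qed.

Lemma msmooth_glue W U (f : M -> W) :
  (forall x, U x -> exists2 U' : set M, U' x & msmooth U' f) -> msmooth U f.
Proof.
move=> h i k; apply: Ck_glue => y [cy /h [U' U'y hU']].
by exists (ccod (mchart i) `&` cinv (mchart i) @^-1` U'); [|exact: hU'].
Qed.

Lemma msmooth_cst W U (w : W) : msmooth U (cst w).
Proof. by move=> i k; exact: Ck_cst. Qed.

Lemma msmoothD W U (f g : M -> W) : open U ->
  msmooth U f -> msmooth U g -> msmooth U (fun x => f x + g x).
Proof.
move=> oU hf hg i k; apply: (CkD _ (hf i k) (hg i k)).
exact: chart_preimage_open.
Qed.

Lemma msmooth_sum W U (I : Type) (r : seq I) (P : pred I) (f : I -> M -> W) :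
  open U -> (forall a, msmooth U (f a)) ->
  msmooth U (fun x => \sum_(a <- r | P a) f a x).
Proof.
move=> oU hf i k.
have oi := chart_preimage_open (i := i) oU.
by apply: (Ck_ext oi _ (Ck_sum r P oi (fun a => hf a i k))).
Qed.

Lemma msmoothZ W U (a : M -> R) (f : M -> W) : open U ->
  msmooth U a -> msmooth U f -> msmooth U (fun x => a x *: f x).
Proof.
move=> oU ha hf i k; apply: (CkZ _ (ha i k) (hf i k)).
exact: chart_preimage_open.
Qed.

Lemma msmooth_coord m U (f : M -> 'rV[R]_m) (a : 'I_m) : open U ->
  msmooth U f -> msmooth U (fun x => f x 0 a).
Proof.
move=> oU hf i k; apply: (Ck_coord a _ (hf i k)).
exact: chart_preimage_open.
Qed.

Lemma transition_open i j : open (ccod (mchart i) `&` cinv (mchart i) @^-1` cdom (mchart j)).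
Proof. exact/chart_preimage_open/cdom_open. Qed.

Lemma transition_differentiable i j x : cdom (mchart i) x -> cdom (mchart j) x ->
  differentiable (cmap (mchart j) \o cinv (mchart i)) (cmap (mchart i) x).
Proof.
move=> xi xj; have [+ _] := atlas_smooth i j 1; apply.
by split; [exact: cmap_cod|rewrite /preimage /= cmapK].
Qed.

Lemma transition_diff_id i x v : cdom (mchart i) x ->
  'd (cmap (mchart i) \o cinv (mchart i)) (cmap (mchart i) x) v = v.
Proof.
move=> xi; have h : \forall y \near cmap (mchart i) x, y = (cmap (mchart i) \o cinv (mchart i)) y.
  near=> y; rewrite /= cinvK //; near: y.
  by apply: open_nbhs_nbhs; split; [exact: ccod_open|exact: cmap_cod].
have [_ ->] := near_eq_diff h (@ex_diff _ _ _ _ _ _ _ (is_diff_id _)).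
by rewrite diff_val.
Unshelve. all: by end_near. Qed.

Lemma transition_diff_comp i j l x v :
  cdom (mchart i) x -> cdom (mchart j) x -> cdom (mchart l) x ->
  'd (cmap (mchart l) \o cinv (mchart j)) (cmap (mchart j) x)
     ('d (cmap (mchart j) \o cinv (mchart i)) (cmap (mchart i) x) v) =
  'd (cmap (mchart l) \o cinv (mchart i)) (cmap (mchart i) x) v.
Proof.
move=> xi xj xl; set y := cmap (mchart i) x.
have zE : (cmap (mchart j) \o cinv (mchart i)) y = cmap (mchart j) x by rewrite /= cmapK.
have dij := transition_differentiable xi xj.
have djl := transition_differentiable xj xl.
rewrite -zE in djl *.
have dc : differentiable
    ((cmap (mchart l) \o cinv (mchart j)) \o (cmap (mchart j) \o cinv (mchart i))) y.
  exact: (differentiable_comp dij djl).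
have h : \forall z \near y,
    ((cmap (mchart l) \o cinv (mchart j)) \o (cmap (mchart j) \o cinv (mchart i))) z =
    (cmap (mchart l) \o cinv (mchart i)) z.
  near=> z; have [_ zj] : (ccod (mchart i) `&` cinv (mchart i) @^-1` cdom (mchart j)) z.
    near: z; apply: open_nbhs_nbhs; split; first exact: transition_open.
    by split; [exact: cmap_cod|rewrite /preimage /= cmapK].
  by rewrite /= cmapK.
have [_ e] := near_eq_diff h dc.
apply: etrans (esym (congr1 (@^~ v) e)).
exact: esym (congr1 (@^~ v) (diff_comp dij djl)).
Unshelve. all: by end_near. Qed.

Lemma transition_diff_smooth i j v :
  msmooth (cdom (mchart i) `&` cdom (mchart j))
    (fun x => 'd (cmap (mchart j) \o cinv (mchart i)) (cmap (mchart i) x) v).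
Proof.
move=> l k.
have oU : open (cdom (mchart i) `&` cdom (mchart j)).
  by apply: openI; exact: cdom_open.
have [_ hv] := atlas_smooth i j k.+1.
have sU y : (ccod (mchart l) `&` cinv (mchart l) @^-1` (cdom (mchart i) `&` cdom (mchart j))) y ->
    (ccod (mchart i) `&` cinv (mchart i) @^-1` cdom (mchart j)) (cmap (mchart i) (cinv (mchart l) y)).
  by move=> [cy [yi yj]]; split; [exact: cmap_cod|rewrite /preimage /= cmapK].
have hli : Ck k (ccod (mchart l) `&` cinv (mchart l) @^-1` (cdom (mchart i) `&` cdom (mchart j)))
    (cmap (mchart i) \o cinv (mchart l)).
  by apply: Ck_sub (atlas_smooth l i k) => y [cy [yi _]].
apply: (Ck_ext _ _ (Ck_comp (chart_preimage_open (i := l) oU) sU hli (hv v))).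
  exact: chart_preimage_open.
move=> y [cy [yi yj]] /=; rewrite deriveE //.
exact: transition_differentiable.
Qed.

Record smooth_fun := SmoothFun {
  smooth_fun_fun :> M -> R;
  smooth_fun_smooth : msmooth setT smooth_fun_fun }.

End SmoothFunctions.

(* A rank-k smooth vector bundle, given by its fibers and a bundle atlas: the
   topology and smooth structure of the total space are those for which the
   local trivializations are diffeomorphisms. triv i x and trivV i x carry no
   information when x is outside tdom i. *)
Record vbundle (R : realType) (n : nat) (M : manifold R n) (k : nat) := VBundle {
  fiber :> M -> lmodType R;
  tindex : Type;
  tdom : tindex -> set M;
  triv : tindex -> forall x, {linear fiber x -> 'rV[R]_k};
  trivV : tindex -> forall x, 'rV[R]_k -> fiber x;
  tdom_open : forall i, open (tdom i);
  tdom_cover : forall x, exists i, tdom i x;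
  trivK : forall i x, tdom i x -> cancel (triv i x) (trivV i x);
  trivVK : forall i x, tdom i x -> cancel (trivV i x) (triv i x);
  triv_smooth : forall i j (v : 'rV[R]_k),
    msmooth (tdom i `&` tdom j) (fun x => triv j x (trivV i x v)) }.

Section TangentBundle.
Context {R : realType} {n : nat} (M : manifold R n).

(* The fiber of TM at x is R^n, a vector being recorded by its components in
   chart_at x; tangent_triv i x is the Jacobian that turns these into the
   components in chart i, so the transition functions are the usual ones. *)
Definition tangent_triv (i : atlas M) (x : M) : {linear 'rV[R]_n -> 'rV[R]_n} :=
  'd (cmap (mchart i) \o cinv (mchart (chart_at x))) (cmap (mchart (chart_at x)) x).

Definition tangent_trivV (i : atlas M) (x : M) : 'rV[R]_n -> 'rV[R]_n :=
  'd (cmap (mchart (chart_at x)) \o cinv (mchart i)) (cmap (mchart i) x).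

Lemma tangent_trivK i x : cdom (mchart i) x ->
  cancel (tangent_triv i x) (tangent_trivV i x).
Proof.
move=> xi v; rewrite /tangent_triv /tangent_trivV.
have xx := chart_atP x.
exact: etrans (transition_diff_comp v xx xi xx) (transition_diff_id v xx).
Qed.

Lemma tangent_trivVK i x : cdom (mchart i) x ->
  cancel (tangent_trivV i x) (tangent_triv i x).
Proof.
move=> xi v; rewrite /tangent_triv /tangent_trivV.
have xx := chart_atP x.
exact: etrans (transition_diff_comp v xi xx xi) (transition_diff_id v xi).
Qed.

Lemma tangent_triv_smooth i j v :
  msmooth (cdom (mchart i) `&` cdom (mchart j))
    (fun x => tangent_triv j x (tangent_trivV i x v)).
Proof.
apply: (msmooth_ext _ _ (transition_diff_smooth i j v)).
  by apply: openI; exact: cdom_open.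
move=> x [xi xj]; exact/esym/(transition_diff_comp v xi (chart_atP x) xj).
Qed.

Definition TM : vbundle M n :=
  @VBundle R n M n (fun _ => 'rV[R]_n : lmodType R) (atlas M)
    (fun i => cdom (mchart i)) tangent_triv tangent_trivV
    (fun i => cdom_open (mchart i)) (@atlas_cover R n M)
    tangent_trivK tangent_trivVK tangent_triv_smooth.

Definition mdiff (W : normedModType R) (f : M -> W) (x : M) :
    {linear TM x -> W} :=
  'd (f \o cinv (mchart (chart_at x))) (cmap (mchart (chart_at x)) x).

End TangentBundle.

Section Sections.
Context {R : realType} {n : nat} {M : manifold R n} {k : nat} (E : vbundle M k).

Definition smooth_section (s : forall x, E x) : Prop :=
  forall i, msmooth (tdom i) (fun x => triv i x (s x)).

Record section := Section {
  section_fun :> forall x, E x;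
  section_smooth : smooth_section section_fun }.

Lemma sectionP (s t : section) : (forall x, s x = t x) -> s = t.
Proof.
case: s t => [s hs] [t ht] /= st.
have e : s = t by apply: functional_extensionality_dep.
by rewrite e in hs *; congr Section; exact: Prop_irrelevance.
Qed.

Lemma section0_smooth : smooth_section (fun x => 0).
Proof.
move=> i; apply: (msmooth_ext _ _ (msmooth_cst (tdom i) 0)).
  exact: tdom_open.
by move=> x _; rewrite linear0.
Qed.

Lemma sectionD_smooth (s t : section) : smooth_section (fun x => s x + t x).
Proof.
move=> i; have oi := tdom_open i.
apply: (msmooth_ext oi _ (msmoothD oi (section_smooth s i) (section_smooth t i))).
by move=> x _; rewrite linearD.
Qed.

Lemma sectionM_smooth (f : smooth_fun M) (s : section) :
  smooth_section (fun x => f x *: s x).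
Proof.
move=> i; have oi := tdom_open i.
have hf := msmooth_sub (@subsetT _ (tdom i)) (smooth_fun_smooth f).
apply: (msmooth_ext oi _ (msmoothZ oi hf (section_smooth s i))).
by move=> x _; rewrite linearZ.
Qed.

Definition fscale (f : smooth_fun M) (s : section) : section :=
  Section (sectionM_smooth f s).

Definition cst_fun (a : R) : smooth_fun M := SmoothFun (msmooth_cst setT a).

Definition section0 : section := Section section0_smooth.
Definition sectionD (s t : section) : section := Section (sectionD_smooth s t).
Definition sectionZ (a : R) (s : section) : section := fscale (cst_fun a) s.

HB.instance Definition _ := gen_eqMixin section.
HB.instance Definition _ := gen_choiceMixin section.

Lemma sectionDA : associative sectionD.
Proof. by move=> s t u; apply: sectionP => x /=; rewrite addrA. Qed.
Lemma sectionDC : commutative sectionD.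
Proof. by move=> s t; apply: sectionP => x /=; rewrite addrC. Qed.
Lemma section0D : left_id section0 sectionD.
Proof. by move=> s; apply: sectionP => x /=; rewrite add0r. Qed.
Lemma sectionND : left_inverse section0 (sectionZ (-1)) sectionD.
Proof. by move=> s; apply: sectionP => x /=; rewrite scaleN1r addNr. Qed.
HB.instance Definition _ :=
  GRing.isZmodule.Build section sectionDA sectionDC section0D sectionND.

Lemma sectionZA a b (s : section) : sectionZ a (sectionZ b s) = sectionZ (a * b) s.
Proof. by apply: sectionP => x /=; rewrite scalerA. Qed.
Lemma section1Z : left_id 1 sectionZ.
Proof. by move=> s; apply: sectionP => x /=; rewrite scale1r. Qed.
Lemma sectionZDr : right_distributive sectionZ +%R.
Proof. by move=> a s t; apply: sectionP => x /=; rewrite scalerDr. Qed.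
Lemma sectionZDl (s : section) : {morph sectionZ^~ s : a b / a + b}.
Proof. by move=> a b; apply: sectionP => x /=; rewrite scalerDl. Qed.
HB.instance Definition _ := GRing.Zmodule_isLmodule.Build R section
  sectionZA section1Z sectionZDr sectionZDl.

Lemma sectionDE (s t : section) x : (s + t) x = s x + t x. Proof. by []. Qed.
Lemma sectionZE a (s : section) x : (a *: s) x = a *: s x. Proof. by []. Qed.
Lemma sectionNE (s : section) x : (- s) x = - s x.
Proof. by rewrite -scaleN1r. Qed.
Lemma sectionBE (s t : section) x : (s - t) x = s x - t x.
Proof. by rewrite sectionDE sectionNE. Qed.

Lemma triv_expand i x (v : E x) : tdom i x ->
  v = \sum_a (triv i x v) 0 a *: trivV i x (delta_mx 0 a).
Proof.
move=> xi; apply: (can_inj (trivK xi)).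
rewrite linear_sum {1}(row_sum_delta (triv i x v)); apply: eq_bigr => a _.
by rewrite linearZ /= trivVK.
Qed.

End Sections.

Section Structures.
Context {R : realType} {n : nat} {M : manifold R n} {k : nat}.

Record bundle_morphism l (E : vbundle M k) (F : vbundle M l) := BundleMorphism {
  bmor :> forall x, {linear E x -> F x};
  bmor_smooth : forall i j (v : 'rV[R]_k),
    msmooth (tdom i `&` tdom j) (fun x => triv j x (bmor x (trivV i x v))) }.

Lemma bmap_smooth l (E : vbundle M k) (F : vbundle M l)
  (rho : bundle_morphism E F) (s : section E) :
  smooth_section (fun x => rho x (s x)).
Proof.
move=> j; apply: msmooth_glue => x xj; have [i xi] := tdom_cover E x.
exists (tdom i `&` tdom j) => //.
have oij : open (tdom i `&` tdom j) by apply: openI; exact: tdom_open.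
have hs : msmooth (tdom i `&` tdom j) (fun x => triv i x (s x)).
  by apply: msmooth_sub (section_smooth s i) => y [].
have h a := msmoothZ oij (msmooth_coord a oij hs) (bmor_smooth rho i j (delta_mx 0 a)).
apply: (msmooth_ext oij _ (msmooth_sum _ xpredT oij h)) => y [yi yj].
rewrite [in RHS](triv_expand (s y) yi) !linear_sum; apply: eq_bigr => a _.
by rewrite !linearZ.
Qed.

Definition bmap l (E : vbundle M k) (F : vbundle M l)
  (rho : bundle_morphism E F) (s : section E) : section F :=
  Section (bmap_smooth rho s).

Record pseudo_metric (E : vbundle M k) := PseudoMetric {
  pmetric :> forall x, {bilinear E x -> E x -> R^o};
  pmetric_sym : forall x u v, pmetric x u v = pmetric x v u;
  pmetric_nondeg : forall x u, (forall v, pmetric x u v = 0) -> u = 0;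
  pmetric_smooth : forall i (u v : 'rV[R]_k),
    msmooth (tdom i) (fun x => pmetric x (trivV i x u) (trivV i x v) : R) }.

(* Elements of Gamma(/\^2 E^* (x) E). *)
Record alt_form (E : vbundle M k) := AltForm {
  aform :> forall x, {bilinear E x -> E x -> E x};
  aform_alt : forall x u, aform x u u = 0;
  aform_smooth : forall i (u v : 'rV[R]_k),
    msmooth (tdom i) (fun x => triv i x (aform x (trivV i x u) (trivV i x v))) }.

Lemma aform_section_smooth (E : vbundle M k) (beta : alt_form E) (s t : section E) :
  smooth_section (fun x => beta x (s x) (t x)).
Proof.
move=> i; have oi := tdom_open i.
have h a b := msmoothZ oi (msmooth_coord a oi (section_smooth s i))
  (msmoothZ oi (msmooth_coord b oi (section_smooth t i))
     (aform_smooth beta i (delta_mx 0 a) (delta_mx 0 b))).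
apply: (msmooth_ext oi _ (msmooth_sum _ xpredT oi
  (fun a => msmooth_sum _ xpredT oi (h a)))) => x xi.
rewrite [in RHS](triv_expand (s x) xi) [in RHS](triv_expand (t x) xi).
rewrite linear_sumlz linear_sum; apply: eq_bigr => a _.
rewrite linear_sumr linear_sum; apply: eq_bigr => b _.
by rewrite linearZl_LR linearZr_LR /= !linearZ /= !scalerA mulrC.
Qed.

Definition aform_section (E : vbundle M k) (beta : alt_form E) (s t : section E) :
  section E := Section (aform_section_smooth beta s t).

Record connection (E : vbundle M k) := Connection {
  nabla :> section (TM M) -> section E -> section E;
  nablaDl : forall X Y s, nabla (X + Y) s = nabla X s + nabla Y s;
  nablaMl : forall f X s, nabla (fscale f X) s = fscale f (nabla X s);
  nablaDr : forall X s t, nabla X (s + t) = nabla X s + nabla X t;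
  nabla_leibniz : forall X (f : smooth_fun M) s x,
    nabla X (fscale f s) x = f x *: nabla X s x + (mdiff f x (X x) : R) *: s x }.

End Structures.

Section LieBracket.
Context {R : realType} {n : nat} {M : manifold R n}.

Definition local_rep (X : section (TM M)) (i : atlas M) (y : 'rV[R]_n) : 'rV[R]_n :=
  tangent_triv i (cinv (mchart i) y) (X (cinv (mchart i) y)).

(* [X, Y]^a = X^b d_b Y^a - Y^b d_b X^a, computed in the chart chart_at x. *)
Definition lie (X Y : section (TM M)) (x : M) : TM M x :=
  let i := chart_at x in
  let y := cmap (mchart i) x in
  tangent_trivV i x ('d (local_rep Y i) y (local_rep X i y) -
                     'd (local_rep X i) y (local_rep Y i y)).

End LieBracket.

Section PseudoEuclidean.
Context {R : realType} {n : nat} {M : manifold R n} {k : nat} {E : vbundle M k}.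
Variables (g : pseudo_metric E) (rho : bundle_morphism E (TM M)).

Definition gdot (s t : section E) (x : M) : R := g x (s x) (t x).

Definition sharp x (alpha : {linear E x -> R^o}) : E x :=
  xget 0 [set u | forall v, g x u v = alpha v].

Lemma sharpP x (alpha : {linear E x -> R^o}) v : g x (sharp alpha) v = alpha v.
Proof.
rewrite /sharp; case: xgetP => [_ _ //|no]; exfalso.
have [i xi] := tdom_cover E x.
pose s a : E x := trivV i x (delta_mx 0 a).
pose A := \matrix_(a < k, b < k) (g x (s a) (s b) : R).
have sE (w : E x) : w = \sum_a (triv i x w) 0 a *: s a by exact: triv_expand.
have gE (w : 'rV[R]_k) b : g x (\sum_a w 0 a *: s a) (s b) = (w *m A) 0 b.
  rewrite linear_sumlz mxE; apply: eq_bigr => a _.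
  by rewrite linearZl_LR mxE.
have uA : A \in unitmx.
  rewrite -row_free_unit -kermx_eq0; apply/eqP/row_matrixP => c.
  rewrite row0; set w := row c _.
  have wA : w *m A = 0 by apply/sub_kermxP; exact: row_sub.
  have z : \sum_a w 0 a *: s a = 0.
    apply: (pmetric_nondeg (p := g)) => u; rewrite [u]sE linear_sumr big1 // => b _.
    by rewrite linearZr_LR gE wA mxE; exact: mulr0.
  have := congr1 (triv i x) z; rewrite linear0 linear_sum => <-.
  rewrite [LHS]row_sum_delta; apply: eq_bigr => a _.
  by rewrite linearZ /= trivVK.
pose w : 'rV[R]_k := (\row_b (alpha (s b) : R)) *m invmx A.
apply: (no (\sum_a w 0 a *: s a)) => u.
rewrite [u]sE linear_sumr linear_sum; apply: eq_bigr => b _.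
by rewrite linearZr_LR linearZ gE /w mulmxKV // mxE.
Qed.

(* alpha \o rho x is the transpose of rho at x applied to the covector alpha. *)
Definition partial x (alpha : {linear TM M x -> R^o}) : E x :=
  2^-1 *: sharp (alpha \o rho x : {linear E x -> R^o}).

Definition partial_fun (f : M -> R) (x : M) : E x :=
  partial (mdiff f x : {linear TM M x -> R^o}).

Definition metric_connection (nabla : connection E) : Prop :=
  forall (X : section (TM M)) (e1 e2 : section E) (x : M),
    mdiff (gdot e1 e2) x (X x) = gdot (nabla X e1) e2 x + gdot e1 (nabla X e2) x.

Definition rho_torsion (nabla : connection E) (e1 e2 : section E) (x : M) : TM M x :=
  rho x ((nabla (bmap rho e1) e2 - nabla (bmap rho e2) e1) x)
  - lie (bmap rho e1) (bmap rho e2) x.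

End PseudoEuclidean.

Section Brackets.
Context {R : realType} {n : nat} {M : manifold R n} {k : nat} {E : vbundle M k}.
Variables (g : pseudo_metric E) (rho : bundle_morphism E (TM M)).
Variable nabla : connection E.

(* c is the section gamma(e1, e2). *)
Definition gamma_eq (e1 e2 c : section E) : Prop :=
  forall (e : section E) (x : M),
    gdot g c e x = 2^-1 * (gdot g e1 (nabla (bmap rho e) e2) x
                           - gdot g e2 (nabla (bmap rho e) e1) x).

Definition bracket0 (gamma : section E -> section E -> section E)
    (e1 e2 : section E) : section E :=
  nabla (bmap rho e1) e2 - nabla (bmap rho e2) e1 - gamma e1 e2.

Definition skew_bracket (br : section E -> section E -> section E) : Prop :=
  bilinear_for *:%R *:%R br /\ forall e1 e2, br e1 e2 = - br e2 e1.

Definition metric_invariant (br : section E -> section E -> section E) : Prop :=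
  forall (e e1 e2 : section E) (x : M),
    mdiff (gdot g e1 e2) x (rho x (e x)) =
      g x (br e e1 x + partial_fun g rho (gdot g e e1) x) (e2 x)
      + g x (e1 x) (br e e2 x + partial_fun g rho (gdot g e e2) x).

Definition anchor_preserves (br : section E -> section E -> section E) : Prop :=
  forall (e1 e2 : section E) (x : M),
    bmap rho (br e1 e2) x = lie (bmap rho e1) (bmap rho e2) x.

Definition totally_skew (beta : alt_form E) : Prop :=
  forall (x : M) (u v w : E x),
    g x (beta x u v) w = - g x (beta x v u) w /\
    g x (beta x u v) w = - g x (beta x u w) v.

Definition rho_partial0 : Prop :=
  forall (x : M) (alpha : {linear TM M x -> R^o}),
    rho x (partial g rho alpha) = 0.

End Brackets.

(* Main.v *)
Require Import Defs.
From HB Require Import structures.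
From mathcomp Require Import all_boot all_order all_algebra.
From mathcomp Require Import all_classical all_reals all_analysis.
From mathcomp Require Import perm ring lra.

Set Implicit Arguments.
Unset Strict Implicit.
Unset Printing Implicit Defensive.

Import Order.TTheory GRing.Theory Num.Theory.
Import numFieldNormedType.Exports.

Local Open Scope classical_set_scope.
Local Open Scope ring_scope.

(** The algebra is short once pointwise objects can be traded for global
    sections. A map from global sections to a vector space that is additive and
    takes multiplication by f to multiplication by f x depends only on the
    value of the section at x ([tensorial_linear]), because a section vanishing
    at x is, up to a cutoff, a combination of frame sections whose coefficients
    vanish at x. The cutoffs ([cutoff_exists]) come from the flat function
    exp (-1/t), read in a chart; the Hausdorff property makes the image of a
    compact cube closed, so that a function supported there extends by zero.

    Part 1. The form defining gamma(e1, e2) is tensorial in e, so it is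
    represented by a section ([section_riesz]); its components are obtained
    from smooth functions by inverting the Gram matrix of g. Property (v) is
    then a computation: rewriting every derivative of a product g(e, e') by
    metricity of nabla, all terms cancel in pairs.

    Part 2. Let D be the difference of two skew brackets satisfying (v).
    Subtracting the two instances of (v) leaves
    g(D(e, e1), e2) + g(e1, D(e, e2)) = 0, and with skewness
    g(D(e1, e2), e3) is totally skew. It is function-linear in e3, hence in
    every argument ([skew_tensorial]), so D is an element of
    Gamma(/\^2 E^* (x) E) ([alt_form_of_tensor]). The converse is
    [bracket_shift].

    Part 3. By definition of the torsion T, the bracket satisfies (i) iff
    T = rho gamma + rho beta ([anchor_preservesE]). The section gamma(e1, e2) is
    the image under the map partial of the covector
    X |-> g(e1, nabla_X e2) - g(e2, nabla_X e1), so rho o partial = 0 kills the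
    term rho gamma ([rho_gamma0]) and leaves rho beta = T. Conversely T and beta
    are tensorial while gamma(f e1, e2) = f gamma(e1, e2) - g(e1, e2) partial f
    ([gamma_fscale]); replacing e1 by f e1 in the identity above gives
    g(e1, e2) rho (partial f) = 0, and nondegeneracy of g together with the fact
    that every covector is a differential yields rho o partial = 0
    ([anchor_rho_partial0]). *)

(** * Flat functions and composition with scalar functions *)

Section Flat.
Context {R : realType}.

(** The functions t^-m exp (-1/t), extended by 0 to t <= 0. The whole family
    is needed because it, unlike its member m = 0, is stable under derivation. *)
Definition flat (m : nat) (t : R) : R :=
  if 0 < t then t^-1 ^+ m * expR (- t^-1) else 0.

(** Writing u = 1/t and N = m + 2, this is u^N <= N^N exp u, which follows from
    exp u = (exp (u/N))^N and exp (u/N) >= u/N. The exponent 2 of t is what makes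
    the derivative at 0 vanish. *)
Lemma flat_le m t : `|flat m t| <= m.+2%:R ^+ m.+2 * t ^+ 2.
Proof.
rewrite /flat; case: ifPn => [t0|_]; last first.
  by rewrite normr0 mulr_ge0 ?sqr_ge0 ?exprn_ge0.
have u0 : 0 < t^-1 by rewrite invr_gt0.
rewrite ger0_norm ?mulr_ge0 ?exprn_ge0 ?expR_ge0 ?(ltW u0)//.
have eu : t^-1 ^+ m.+2 <= m.+2%:R ^+ m.+2 * expR (t^-1).
  have n0 : (m.+2%:R : R) != 0 by rewrite pnatr_eq0.
  rewrite -[in expR _](divfK n0 t^-1) expRM_natr -exprMn.
  apply: lerXn2r; rewrite ?nnegrE ?mulr_ge0 ?expR_ge0 ?(ltW u0)//.
  rewrite mulrC -ler_pdivrMr ?ltr0n//.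
  by apply: le_trans (expR_ge1Dx _); rewrite lerDr.
rewrite expRN -(ler_pM2r (expR_gt0 t^-1)) mulrVK ?unitfE ?gt_eqF ?expR_gt0//.
rewrite mulrAC -ler_pdivrMr ?exprn_gt0// -exprVn -exprD addn2//.
Qed.

Lemma flat_is_derive m (t : R) :
  is_derive t (1 : R) (flat m) (flat m.+2 t - m%:R * flat m.+1 t).
Proof.
have [t0|t0|->] := ltgtP t 0.
- rewrite {2 3}/flat !ifF ?mulr0 ?subr0; try by apply/negbTE; rewrite -leNgt ltW.
  apply: (@near_eq_is_derive _ _ _ (cst 0)).
  near=> y; rewrite /flat ifF//; apply/negbTE; rewrite -leNgt ltW//.
  near: y; exact: lt_nbhsl.
- rewrite {2 3}/flat t0.
  pose f (y : R) := y^-1 ^+ m * expR (- y^-1).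
  apply: (@near_eq_is_derive _ _ _ f).
  near=> y; rewrite /flat ifT//; near: y; exact: lt_nbhsr.
  have tn : t != 0 by rewrite gt_eqF.
  have dv : is_derive t (1:R) (fun y : R => y^-1) (- t ^- 2).
    have h := @is_deriveV R id t 1 1 tn (is_derive_id t 1).
    by apply: (is_derive_eq h); rewrite /= [_ *: _]mulr1.
  have dx := @is_deriveX R R (fun y : R => y^-1) m t 1 _ dv.
  have de : is_derive t (1:R) (fun y : R => expR (- y^-1)) (expR (- t^-1) * t ^- 2).
    have h := @is_derive1_comp R expR (fun y => - y^-1) t _ _
      (is_derive_expR (- t^-1)) (is_deriveN dv).
    by apply: (is_derive_eq h); rewrite opprK.
  have -> : f = (fun y : R => y^-1) ^+ m * (fun y : R => expR (- y^-1)).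
    by apply/funext => y; rewrite /f !fctE.
  apply: (is_derive_eq (is_deriveM dx de)).
  rewrite /GRing.scale /= !fctE -!exprVn; set u := t^-1.
  by case: m {dx f} => [|m] /=; rewrite ?exprS; ring.
rewrite {2 3}/flat ltxx mulr0 subr0.
(* By [flat_le] the difference quotient at 0 is O(h). *)
have cv : h^-1 *: ((flat m \o shift 0) (h *: (1:R)) - flat m 0) @[h --> (0:R)^'] --> (0:R).
  pose C : R := m.+2%:R ^+ m.+2.
  have C0 : 0 < C by rewrite exprn_gt0.
  apply/cvgr0Pnorm_le => e e0; near=> h.
  have h0 : h != 0 by near: h; exact: nbhs_dnbhs_neq.
  have hC : `|h| <= e / C by near: h; apply: dnbhs0_le; rewrite divr_gt0.
  rewrite /= [h *: _]mulr1 addr0 {2}/flat ltxx subr0 normrM normfV.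
  rewrite mulrC ler_pdivrMr ?normr_gt0//; apply: le_trans (flat_le m h) _.
  rewrite -/C -(ger0_norm (sqr_ge0 h)) normrX expr2 mulrA ler_pM2r ?normr_gt0//.
  by rewrite mulrC -ler_pdivlMr.
by split; [apply/cvg_ex; exists 0|exact: cvg_lim cv].
Unshelve. all: by end_near.
Qed.

End Flat.

Section ScalarComposition.
Context {R : realType}.

Lemma derive_comp1 (V : normedModType R) (q : V -> R) (phi : R -> R) (d : R) x :
  differentiable q x -> is_derive (q x) (1 : R) phi d ->
  differentiable (phi \o q) x /\ forall v, 'D_v (phi \o q) x = d *: 'D_v q x.
Proof.
move=> dq dphi; have dp : differentiable phi (q x) by apply/derivable1_diffP; case: dphi.
have dc := differentiable_comp dq dp.
split=> // v; rewrite deriveE// diff_comp//= -(deriveE v dq) (diff1E dp).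
by rewrite derive1E (@derive_val _ _ _ _ _ _ _ dphi) /= [LHS]mulrC.
Qed.

(** Smoothness by induction on k for all members of the family at once: a
    recurrence expressing derivatives within the family is all that is used, and
    it covers both the flat functions and the powers of the inverse. *)
Lemma Ck_comp_family (V : normedModType R) (phi : nat -> R -> R) (a b : nat -> R)
    (D : set R) k (U : set V) (q : V -> R) m : open U ->
  (forall m t, D t ->
     is_derive t (1 : R) (phi m) (a m * phi m.+1 t + b m * phi m.+2 t)) ->
  (forall x, U x -> D (q x)) -> Ck k U q -> Ck k U (phi m \o q).
Proof.
move=> oU dphi qD; elim: k m => [|k IH] m hq.
  move=> x Ux; apply: continuous_comp; first exact: hq.
  apply: differentiable_continuous; apply/derivable1_diffP.
  by case: (dphi m _ (qD _ Ux)).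
have hq' := Ck_pred hq; case: hq => q1 q2; split=> [x Ux|v].
  exact: (derive_comp1 (q1 _ Ux) (dphi m _ (qD _ Ux))).1.
have h c l : Ck k U (fun x => c *: (phi l \o q) x).
  exact: (CkZ oU (Ck_cst _ _ c) (IH l hq')).
apply: (Ck_ext oU _ (CkZ oU (CkD oU (h (a m) m.+1) (h (b m) m.+2)) (q2 v))).
by move=> x Ux; rewrite (derive_comp1 (q1 _ Ux) (dphi m _ (qD _ Ux))).2.
Qed.

Lemma Ck_flat (V : normedModType R) k (U : set V) (q : V -> R) : open U ->
  Ck k U q -> Ck k U (flat 0 \o q).
Proof.
move=> oU; apply: (Ck_comp_family (phi := flat) (a := fun m => - m%:R)
  (b := fun=> 1) (D := setT) 0 oU) => // m t _.
by apply: is_derive_eq (flat_is_derive m t) _; rewrite mul1r mulNr addrC.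
Qed.

Lemma Ck_inv (V : normedModType R) k (U : set V) (q : V -> R) : open U ->
  (forall x, U x -> q x != 0) -> Ck k U q -> Ck k U (fun x => (q x)^-1).
Proof.
move=> oU q0 hq.
apply: (Ck_comp_family (phi := fun m t => t^-1 ^+ m) (a := fun m => - m%:R)
  (b := fun=> 0) (D := [set t | t != 0]) 1 oU _ q0 hq) => m t /= t0.
have h := @is_deriveV R id t 1 1 t0 (is_derive_id t 1).
have -> : (fun t : R => t^-1 ^+ m) = (fun t : R => t^-1) ^+ m.
  by apply/funext => y; rewrite !fctE.
apply: (is_derive_eq (@is_deriveX R R _ m t 1 _ h)).
rewrite /GRing.scale /= -!exprVn; set u := t^-1.
by case: m => [|m]; rewrite ?exprS /=; ring.
Qed.

End ScalarComposition.

(** * Smooth functions on a manifold and cutoffs *)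

Section SmoothScalars.
Context {R : realType} {n : nat} (M : manifold R n).
Implicit Types (U V K : set M) (W : normedModType R).

Lemma msmooth_flat U (q : M -> R) : open U ->
  msmooth U q -> msmooth U (fun x => flat 0 (q x)).
Proof. by move=> oU hq i k; exact: Ck_flat (chart_preimage_open oU) (hq i k). Qed.

Lemma msmooth_inv U (q : M -> R) : open U -> (forall x, U x -> q x != 0) ->
  msmooth U q -> msmooth U (fun x => (q x)^-1).
Proof.
move=> oU q0 hq i k; apply: Ck_inv (hq i k); first exact: chart_preimage_open.
by move=> y [_ /q0].
Qed.

Lemma msmooth_chart (i : atlas M) : msmooth (cdom (mchart i)) (cmap (mchart i)).
Proof. by move=> j; exact: atlas_smooth. Qed.

Lemma msmoothM U (f g : M -> R) : open U ->
  msmooth U f -> msmooth U g -> msmooth U (fun x => f x * g x).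
Proof. exact: msmoothZ. Qed.

Lemma msmooth_prod U (I : Type) (r : seq I) (f : I -> M -> R) : open U ->
  (forall a, msmooth U (f a)) -> msmooth U (fun x => \prod_(a <- r) f a x).
Proof.
move=> oU hf; elim: r => [|a r IH].
  by apply: (msmooth_ext oU _ (msmooth_cst U (1 : R))) => x _; rewrite big_nil.
by apply: (msmooth_ext oU _ (msmoothM oU (hf a) IH)) => x _; rewrite big_cons.
Qed.

Lemma msmooth_det U m (A : M -> 'M[R]_m) : open U ->
  (forall a b, msmooth U (fun x => A x a b)) -> msmooth U (fun x => \det (A x)).
Proof.
move=> oU hA.
have h (s : 'S_m) : msmooth U (fun x => cst ((-1) ^+ s : R) x * \prod_a A x a (s a)).
  apply: msmoothM => //; first exact: msmooth_cst.
  by apply: msmooth_prod => // a; exact: hA.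
by apply: (msmooth_ext oU _ (msmooth_sum _ xpredT oU h)).
Qed.

(** Cramer's rule: the entries of the inverse are rational in those of A. *)
Lemma msmooth_invmx U m (A : M -> 'M[R]_m) : open U ->
  (forall x, U x -> A x \in unitmx) ->
  (forall a b, msmooth U (fun x => A x a b)) ->
  forall a b, msmooth U (fun x => invmx (A x) a b).
Proof.
move=> oU uA hA a b.
have hadj : msmooth U (fun x => \adj (A x) a b).
  pose c : R := (-1) ^+ (b + a).
  have h := msmoothM oU (msmooth_cst _ c)
    (@msmooth_det U m.-1 (fun x => row' b (col' a (A x))) oU _).
  apply: (msmooth_ext oU _ (h _)) => [x _|a' b']; first by rewrite mxE.
  by apply: (msmooth_ext oU _ (hA (lift b a') (lift a b'))) => x _; rewrite !mxE.
have hdet := msmooth_inv oU _ (msmooth_det oU hA).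
apply: (msmooth_ext oU _ (msmoothM oU (hdet _) hadj)) => x Ux.
  by rewrite /invmx (uA _ Ux) [RHS]mxE.
by have := uA x Ux; rewrite unitmxE unitfE.
Qed.

End SmoothScalars.

Section Cutoff.
Context {R : realType} {n : nat} (M : manifold R n).
Implicit Types (U V K : set M) (W : normedModType R).

(** A closed set containing the support is kept explicit: what matters is that
    chi vanishes on an open set that covers, together with U, the manifold. *)
Definition supported_in (chi : M -> R) U :=
  exists K, [/\ closed K, K `<=` U & forall x, ~ K x -> chi x = 0].

(** Extension by zero: outside U the values of f are irrelevant, since chi
    vanishes near every point there. *)
Lemma supported_smooth W U V (chi : M -> R) (f : M -> W) :
  open V -> open U -> supported_in chi U -> msmooth V chi ->
  msmooth (V `&` U) f -> msmooth V (fun x => chi x *: f x).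
Proof.
move=> oV oU [K [cK KU chi0]] hchi hf; apply: msmooth_glue => x Vx.
have [Kx|nKx] := pselect (K x).
  exists (V `&` U); first by split=> //; exact: KU.
  by apply: msmoothZ => //; [exact: openI|apply: msmooth_sub hchi => y []].
exists (~` K) => //; apply: (msmooth_ext _ _ (msmooth_cst _ 0)) => [|y nKy].
  exact: closed_openC.
by rewrite /= chi0// scale0r.
Qed.

(** This is where the Hausdorff property enters; without it a bump function
    in a chart need not extend by zero. *)
Lemma compact_chart_image i (B : set 'rV[R]_n) :
  compact B -> B `<=` ccod (mchart i) -> closed (cinv (mchart i) @` B : set M).
Proof.
move=> cB BD; apply: compact_closed; first exact: manifold_hausdorff.
apply: continuous_compact => //; apply: continuous_in_subspaceT => y /set_mem By.
exact/cinv_continuous/BD.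
Qed.

(** In the chart at x, chi is the flat function of e^2 - |y - y0|^2, normalised at
    y0. The Euclidean square is smooth, and its sublevel set lies in the
    compact cube of half-side e around y0. *)
Lemma cutoff_exists U x : open U -> U x ->
  exists2 chi : smooth_fun M, supported_in chi U & chi x = 1.
Proof.
move=> oU Ux; set i := chart_at x; set y0 := cmap (mchart i) x.
have xi : cdom (mchart i) x := chart_atP x.
have oD := chart_preimage_open (i := i) oU.
have Dy0 : (ccod (mchart i) `&` cinv (mchart i) @^-1` U) y0.
  by split; [exact: cmap_cod|rewrite /preimage /= cmapK].
have /nbhs_ballP[r /= r0 rD] := open_nbhs_nbhs (conj oD Dy0).
(* The closed cube of half-side e must fit into the open ball of radius r. *)
pose e := r / 2; have e0 : 0 < e by rewrite divr_gt0.
have er : e < r by rewrite ltr_pdivrMr// ltr_pMr// ltr1n.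
pose B := [set y : 'rV[R]_n | forall a, `[y0 0 a - e, y0 0 a + e]%classic (y ord0 a)].
have cB : compact B.
  apply: (@rV_compact _ _ (fun a => `[y0 0 a - e, y0 0 a + e]%classic)) => a.
  exact: segment_compact.
have BD : B `<=` ccod (mchart i) `&` cinv (mchart i) @^-1` U.
  move=> y By; apply: rD; split=> // a b; rewrite ord1.
  have := By b; rewrite /= in_itv/= -ler_distl distrC => h.
  exact: le_lt_trans er.
pose K : set M := cinv (mchart i) @` B.
have cK : closed K by apply: compact_chart_image => // y /BD[].
pose q (z : M) : R := e ^+ 2 - \sum_a (cmap (mchart i) z 0 a - y0 0 a) ^+ 2.
have oi : open (cdom (mchart i)) by exact: cdom_open.
have hq : msmooth (cdom (mchart i)) q.
  have hd a : msmooth (cdom (mchart i)) (fun z => cmap (mchart i) z 0 a + cst (- y0 0 a) z).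
    by apply: msmoothD => //; [exact: msmooth_coord (msmooth_chart i)|exact: msmooth_cst].
  have hs := msmooth_sum _ xpredT oi (fun a => msmoothM oi (hd a) (hd a)).
  have h := msmoothD oi (msmooth_cst _ (e ^+ 2)) (msmoothM oi (msmooth_cst _ (-1 : R)) (hs _)).
  by apply: (msmooth_ext oi _ (h _)) => z _; rewrite /q /= mulN1r.
have qK z : cdom (mchart i) z -> ~ K z -> flat 0 (q z) = 0.
  move=> zi nKz; rewrite /flat ifF//; apply/negP; rewrite subr_gt0 => qz.
  apply: nKz; exists (cmap (mchart i) z); last exact: cmapK.
  move=> a; rewrite /= in_itv/= -ler_distl.
  rewrite -(@ler_pXn2r _ 2)// ?nnegrE ?normr_ge0 ?(ltW e0)//.
  rewrite real_normK ?num_real//.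
  apply: le_trans (ltW qz); rewrite (bigD1 a)//= lerDl sumr_ge0// => b _; exact: sqr_ge0.
pose chi z : R := if `[< cdom (mchart i) z >] then flat 0 (q z) / flat 0 (e ^+ 2) else 0.
have chi0 z : ~ K z -> chi z = 0.
  by rewrite /chi; case: asboolP => // zi nKz; rewrite qK// mul0r.
have hchi : msmooth setT chi.
  apply: msmooth_glue => z _; have [Kz|nKz] := pselect (K z).
    exists (cdom (mchart i)); first by case: Kz => y /BD[+ _] <-; exact: cinv_dom.
    have h := msmoothM oi (msmooth_flat oi hq) (msmooth_cst _ (flat 0 (e ^+ 2))^-1).
    by apply: (msmooth_ext oi _ h) => y yi; rewrite /chi asboolT.
  exists (~` K) => //; have oK : open (~` K) by exact: closed_openC.
  by apply: (msmooth_ext oK _ (msmooth_cst _ 0)) => y /chi0.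
exists (SmoothFun hchi); last rewrite /= /chi asboolT//.
  by exists K; split=> // z [y By <-]; have [] := BD y By.
have -> : q x = e ^+ 2.
  by rewrite /q big1 ?subr0// => a _; rewrite subrr expr0n.
by rewrite divff// /flat ifT ?exprn_gt0// expr0 mul1r gt_eqF ?expR_gt0.
Qed.

End Cutoff.

(** * Tensoriality *)

Section Frames.
Context {R : realType} {n k : nat} {M : manifold R n} (E : vbundle M k).
Implicit Types (chi : smooth_fun M) (i j : tindex E).

Lemma frame_smooth chi i (v : 'rV[R]_k) : supported_in chi (tdom i) ->
  smooth_section (E := E) (fun x => chi x *: trivV i x v).
Proof.
move=> si j; have oi := tdom_open i; have oj := tdom_open j.
have h : msmooth (tdom j `&` tdom i) (fun x => triv j x (trivV i x v)).
  by rewrite setIC; exact: triv_smooth.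
apply: (msmooth_ext oj _ (supported_smooth oj oi si _ h)) => [x _|].
  by rewrite linearZ.
exact: msmooth_sub (@subsetT _ _) (smooth_fun_smooth chi).
Qed.

Definition frame chi i (si : supported_in chi (tdom i)) (v : 'rV[R]_k) : section E :=
  Section (frame_smooth v si).

Lemma coordinate_smooth chi i (s : section E) a : supported_in chi (tdom i) ->
  msmooth setT (fun x => chi x *: (triv i x (s x) 0 a : R)).
Proof.
move=> si; have oi := tdom_open i.
apply: (supported_smooth openT oi si (smooth_fun_smooth chi)).
by rewrite setTI; apply: msmooth_coord (section_smooth s i).
Qed.

Lemma sum_sectionE (I : Type) (r : seq I) (s : I -> section E) x :
  (\sum_(a <- r) s a) x = \sum_(a <- r) s a x.
Proof. by elim/big_rec2: _ => [//|a y z _ <-]. Qed.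

(** One factor chi makes the coordinates global functions, the other makes the
    frame a family of global sections. *)
Lemma frame_expand chi i (si : supported_in chi (tdom i)) (s : section E) :
  fscale chi (fscale chi s) =
  \sum_a fscale (SmoothFun (coordinate_smooth s a si)) (frame si (delta_mx 0 a)).
Proof.
apply: sectionP => x; rewrite sum_sectionE /=.
have [xi|nxi] := pselect (tdom i x).
  rewrite {1}(triv_expand (s x) xi) !scaler_sumr; apply: eq_bigr => a _.
  by rewrite !scalerA mulrAC.
have -> : chi x = 0.
  by case: si => K [_ Ki chi0]; apply: chi0 => /Ki.
by rewrite scale0r big1// => a _; rewrite !scale0r.
Qed.

Lemma section_extend x (v : E x) : exists s : section E, s x = v.
Proof.
have [i xi] := tdom_cover E x.
have [chi si chix] := cutoff_exists (tdom_open i) xi.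
by exists (frame si (triv i x v)); rewrite /= chix scale1r trivK.
Qed.

(** Function-linearity of a map of sections, evaluated at one point. *)
Definition tensorial_at (V : lmodType R) x (Phi : section E -> V) :=
  (forall s t, Phi (s + t) = Phi s + Phi t) /\
  (forall (f : smooth_fun M) s, Phi (fscale f s) = f x *: Phi s).

(** By [frame_expand], chi^2 s is a combination of frame sections with
    coefficients vanishing at x, while chi^2 = 1 at x. *)
Lemma tensorial_vanish (V : lmodType R) x (Phi : section E -> V) (s : section E) :
  tensorial_at x Phi -> s x = 0 -> Phi s = 0.
Proof.
move=> [PhiD PhiZ] sx0.
have [i xi] := tdom_cover E x.
have [chi si chix] := cutoff_exists (tdom_open i) xi.
have Phi0 : Phi 0 = 0 by apply: (addrI (Phi 0)); rewrite -PhiD !addr0.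
have PhiS (I : Type) (r : seq I) (F : I -> section E) :
    Phi (\sum_(a <- r) F a) = \sum_(a <- r) Phi (F a).
  by elim: r => [|a r IH]; rewrite ?big_nil// !big_cons PhiD IH.
have <- : Phi (fscale chi (fscale chi s)) = Phi s by rewrite !PhiZ chix !scale1r.
rewrite (frame_expand si) PhiS big1// => a _.
by rewrite PhiZ /= sx0 linear0 mxE scaler0 scale0r.
Qed.

(** Every vector at x extends to a global section, and by [tensorial_vanish] the
    value of Phi does not depend on the extension. *)
Lemma tensorial_linear (V : lmodType R) x (Phi : section E -> V) :
  tensorial_at x Phi ->
  exists alpha : {linear E x -> V}, forall s, Phi s = alpha (s x).
Proof.
move=> tPhi; have [PhiD PhiZ] := tPhi.
have [ext extE] := boolp.choice (@section_extend x).
have Phi_eq (s t : section E) : s x = t x -> Phi s = Phi t.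
  move=> st; apply/eqP; rewrite -subr_eq0; apply/eqP.
  have -> : - Phi t = Phi (- t) by rewrite -[- t]/(fscale (cst_fun (-1)) t) PhiZ scaleN1r.
  by rewrite -PhiD; apply: tensorial_vanish tPhi _; rewrite sectionBE st subrr.
pose alpha v := Phi (ext v).
have lin : linear alpha.
  move=> a u v; rewrite /alpha -(PhiZ (cst_fun a)) -PhiD; apply: Phi_eq.
  by rewrite sectionDE /= !extE.
pose linM := GRing.isLinear.Build _ _ _ _ _ lin.
pose alphaL : {linear E x -> V} := HB.pack alpha linM.
by exists alphaL => s; apply: Phi_eq; rewrite extE.
Qed.

End Frames.

(** * Differentials and the Lie bracket *)

Section Derivations.
Context {R : realType} {n : nat} (M : manifold R n).
Implicit Types (f : smooth_fun M) (x : M).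

Lemma row_form_continuous (l : {linear 'rV[R]_n -> R^o}) : continuous l.
Proof.
have -> : (l : 'rV[R]_n -> R^o) = \sum_a (fun y : 'rV[R]_n => y 0 a *: l (delta_mx 0 a)).
  apply/funext => y; rewrite fct_sumE {1}(row_sum_delta y) linear_sum.
  by apply: eq_bigr => a _; rewrite linearZ.
move=> y; apply: (@big_ind _ (fun h : 'rV[R]_n -> R^o => {for y, continuous h})).
- exact: cst_continuous.
- by move=> h1 h2 c1 c2; exact: continuousD.
move=> a _; have c : continuous (fun N : 'rV[R]_n => N 0 a : R).
  exact: coord_continuous.
exact: cvgZr_tmp (c y).
Qed.

Lemma smooth_differentiable (W : normedModType R) (U : set M) (h : M -> W) i x :
  msmooth U h -> U x -> cdom (mchart i) x ->
  differentiable (h \o cinv (mchart i)) (cmap (mchart i) x).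
Proof.
move=> hh Ux xi; have [+ _] := hh i 1%N; apply.
by split; [exact: cmap_cod|rewrite /preimage /= cmapK].
Qed.

Lemma mdiff_cst (W : normedModType R) (w : W) x v : mdiff (cst w : M -> W) x v = 0.
Proof.
by rewrite /mdiff (_ : cst w \o _ = cst w)// diff_cst.
Qed.

(** The function is alpha, transported by the chart, centred at x and cut off.
    Since the centred function vanishes at x, the derivative of the cutoff does
    not contribute. *)
Lemma mdiff_surjective x (alpha : {linear TM M x -> R^o}) :
  exists f, forall v, mdiff f x v = alpha v.
Proof.
set i := chart_at x; have xi : cdom (mchart i) x := chart_atP x.
have oi := cdom_open (mchart i).
pose l : {linear 'rV[R]_n -> R^o} := alpha.
have cl : continuous l by exact: row_form_continuous.
have [chi si chix] := cutoff_exists oi xi.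
set y0 := cmap (mchart i) x.
have hl : msmooth (cdom (mchart i)) (fun z => l (cmap (mchart i) z) + cst (- l y0) z).
  apply: (msmoothD oi _ (msmooth_cst _ _)) => j k.
  exact: (Ck_lin (chart_preimage_open oi) cl (@msmooth_chart _ _ M i j k)).
have hf := supported_smooth openT oi si (smooth_fun_smooth chi)
  (msmooth_sub (@subIsetr _ _ _) hl).
exists (SmoothFun hf) => v; rewrite /mdiff -/i -/y0 /=.
have dchi := smooth_differentiable (smooth_fun_smooth chi) I xi.
have dl : differentiable (fun y => l y + cst (- l y0) y) y0.
  by apply: differentiableD => //; exact: linear_differentiable.
have [ds Ds] := diff_scale dchi dl.
have near_f : \forall y \near y0,
    (chi \o cinv (mchart i)) y *: (l y + cst (- l y0) y) =
    ((fun z => chi z *: (l (cmap (mchart i) z) + cst (- l y0) z)) \o cinv (mchart i)) y.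
  near=> y; rewrite /= cinvK//; near: y.
  by apply: open_nbhs_nbhs; split; [exact: ccod_open|exact: cmap_cod].
have [dF ->] := near_eq_diff near_f ds.
rewrite -(deriveE v ds) Ds /= subrr scaler0 add0r cmapK// chix scale1r.
rewrite deriveE// diffD//; last exact: linear_differentiable.
by rewrite /= diff_cst addr0 diff_lin.
Unshelve. all: by end_near. Qed.

Lemma local_rep_differentiable (X : section (TM M)) i x :
  cdom (mchart i) x ->
  differentiable (local_rep X i) (cmap (mchart i) x).
Proof. by move=> xi; exact: (smooth_differentiable (section_smooth X i) xi xi). Qed.

Lemma tangent_trivV_at x v : tangent_trivV (M := M) (chart_at x) x v = v.
Proof. exact: transition_diff_id (chart_atP x). Qed.

Lemma local_rep_at (X : section (TM M)) x :
  local_rep X (chart_at x) (cmap (mchart (chart_at x)) x) = X x.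
Proof.
rewrite /local_rep cmapK; last exact: chart_atP.
exact: (transition_diff_id _ (chart_atP x)).
Qed.

(** At its own base point the chart identifies tangent vectors with their
    components, so the chart Jacobians disappear from the definition. *)
Lemma lieE (X Y : section (TM M)) x :
  let D Z := 'd (local_rep Z (chart_at x)) (cmap (mchart (chart_at x)) x) in
  lie X Y x = D Y (X x) - D X (Y x).
Proof.
apply: etrans (tangent_trivV_at _ _) _.
by rewrite !local_rep_at.
Qed.

Lemma diff_scaleE (V W : normedModType R) (c : V -> R) (h : V -> W) (x v : V) :
  differentiable c x -> differentiable h x ->
  'd (fun y => c y *: h y) x v = ('d c x v : R) *: h x + c x *: 'd h x v.
Proof.
move=> dc dh; have [ds Ds] := diff_scale dc dh.
by rewrite -(deriveE v ds) Ds !deriveE.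
Qed.

Lemma lie_fscalel f (X Y : section (TM M)) x :
  lie (fscale f X) Y x = f x *: lie X Y x - (mdiff f x (Y x) : R) *: X x.
Proof.
rewrite !lieE /mdiff; set i := chart_at x; have xi : cdom (mchart i) x := chart_atP x.
set y := cmap (mchart i) x.
have dX := local_rep_differentiable X xi.
have df := smooth_differentiable (smooth_fun_smooth f) I xi.
have E : local_rep (fscale f X) i =
    (fun z => (f \o cinv (mchart i)) z *: local_rep X i z).
  by apply/funext => z; rewrite /local_rep /= linearZ.
have dE : 'd (local_rep (fscale f X) i) y (Y x) =
    ('d (f \o cinv (mchart i)) y (Y x) : R) *: X x + f x *: 'd (local_rep X i) y (Y x).
  rewrite E; apply: etrans (diff_scaleE _ df dX) _.
  by rewrite /y /i local_rep_at /= cmapK.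
have dYX : 'd (local_rep Y i) y (fscale f X x) = f x *: 'd (local_rep Y i) y (X x).
  exact: linearZ.
apply: etrans (congr2 (fun u v => u - v) dYX dE) _.
have aux (V : lmodType R) (a b : R) (u v w : V) :
    a *: u - (b *: v + a *: w) = a *: (u - w) - b *: v.
  by rewrite scalerBr opprD addrCA addrC.
exact: aux.
Qed.

End Derivations.

(** * From tensorial maps to smooth sections *)

Section TensorialSections.
Context {R : realType} {n k : nat} {M : manifold R n} (E : vbundle M k).

Lemma smooth_continuous (f : smooth_fun M) : continuous (f : M -> R).
Proof.
move=> x; have [i xi] := atlas_cover x.
have h : {for x, continuous ((f \o cinv (mchart i)) \o cmap (mchart i))}.
  apply: continuous_comp; first exact: cmap_continuous.
  exact: differentiable_continuous (smooth_differentiable (smooth_fun_smooth f) I xi).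
have fx : f x = ((f \o cinv (mchart i)) \o cmap (mchart i)) x by rewrite /= cmapK.
rewrite /continuous_at fx; apply: cvg_trans h; apply: near_eq_cvg.
near=> y; rewrite /= cmapK//; near: y.
by apply: open_nbhs_nbhs; split => //; exact: cdom_open.
Unshelve. all: by end_near. Qed.

Lemma msmooth_row m (U : set M) (f : M -> 'rV[R]_m) : open U ->
  (forall a, msmooth U (fun x => f x 0 a)) -> msmooth U f.
Proof.
move=> oU hf.
have h a := msmoothZ oU (hf a) (msmooth_cst U (delta_mx 0 a : 'rV[R]_m)).
apply: (msmooth_ext oU _ (msmooth_sum _ xpredT oU h)) => x _.
by rewrite [RHS]row_sum_delta.
Qed.

(** On U one may divide by chi, so local expressions can be recovered from the
    global frame sections. *)
Lemma local_cutoff (i : tindex E) x : tdom i x ->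
  exists (chi : smooth_fun M) (U : set M),
    [/\ supported_in chi (tdom i), open U, U x, U `<=` tdom i &
        forall y, U y -> chi y != 0].
Proof.
move=> xi; have [chi si chix] := cutoff_exists (tdom_open i) xi.
exists chi, (tdom i `&` chi @^-1` [set t | t != 0]); split=> //.
- apply: openI; first exact: tdom_open.
  by apply: open_comp (@open_neq _ 0) => y _; exact: smooth_continuous.
- by split=> //=; rewrite chix oner_neq0.
- by move=> y [_].
Qed.

(** The converse of [aform_section]. Pointwise the form is beta on extensions of
    the two vectors; for smoothness, beta of two frame sections equals chi^2 times
    the component of the form, and chi can be divided out locally. *)
Lemma alt_form_of_tensor (beta : section E -> section E -> section E) :
  (forall t x, tensorial_at x (fun s => beta s t x)) ->
  (forall s x, tensorial_at x (fun t => beta s t x)) ->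
  (forall s, beta s s = 0) ->
  exists b : alt_form E, forall s t, aform_section b s t = beta s t.
Proof.
move=> tl tr alt.
have ext x : exists e : E x -> section E, forall v, e v x = v.
  by have [e eE] := boolp.choice (@section_extend _ _ _ _ E x); exists e.
pose e x := projT1 (cid (ext x)).
have eE x v : e x v x = v := projT2 (cid (ext x)) v.
pose b x u v : E x := beta (e x u) (e x v) x.
have bE (s t : section E) x : b x (s x) (t x) = beta s t x.
  have [l lE] := tensorial_linear (tl (e x (t x)) x).
  have [r rE] := tensorial_linear (tr s x).
  by rewrite /b lE eE -lE rE eE -rE.
have blin x : bilinear_for (GRing.Scale.Law.clone _ _ *:%R _)
    (GRing.Scale.Law.clone _ _ *:%R _) (b x).
  split=> [w|u] c u1 u2 /=.
    have [l lE] := tensorial_linear (tl (e x w) x).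
    by rewrite /b !lE !eE linearP.
  have [r rE] := tensorial_linear (tr (e x u) x).
  by rewrite /b !rE !eE linearP.
pose B x : {bilinear E x -> E x -> E x} :=
  HB.pack (b x) (bilinear_isBilinear.Build R (E x) (E x) (E x) _ _ (b x) (blin x)).
have Balt x u : B x u u = 0 by rewrite /= /b alt.
have Bsmooth i (u v : 'rV[R]_k) :
    msmooth (tdom i) (fun x => triv i x (B x (trivV i x u) (trivV i x v))).
  apply: msmooth_glue => x xi.
  have [chi [U [si oU Ux Ui chi0]]] := local_cutoff xi.
  exists U => //.
  have hc := msmooth_inv oU chi0 (msmooth_sub (@subsetT _ U) (smooth_fun_smooth chi)).
  have hb := msmooth_sub Ui (section_smooth (beta (frame si u) (frame si v)) i).
  apply: (msmooth_ext oU _ (msmoothZ oU hc (msmoothZ oU hc hb))) => y Uy /=.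
  rewrite -bE /= -[b y]/(B y : E y -> E y -> E y) linearZl_LR linearZr_LR.
  by rewrite !linearZ /= !scalerA mulVf ?chi0// mul1r divff ?chi0// scale1r.
exists (AltForm Balt Bsmooth) => s t; apply: sectionP => x /=; exact: bE.
Qed.

Variable g : pseudo_metric E.

Lemma gdot_smooth (s t : section E) : msmooth setT (gdot g s t).
Proof.
apply: msmooth_glue => x _; have [i xi] := tdom_cover E x.
exists (tdom i) => //; have oi := tdom_open i.
have h a b := msmoothM oi (msmooth_coord a oi (section_smooth s i))
  (msmoothM oi (msmooth_coord b oi (section_smooth t i))
     (pmetric_smooth g i (delta_mx 0 a) (delta_mx 0 b))).
apply: (msmooth_ext oi _ (msmooth_sum _ xpredT oi
  (fun a => msmooth_sum _ xpredT oi (h a)))) => y yi.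
rewrite /gdot [in RHS](triv_expand (s y) yi) [in RHS](triv_expand (t y) yi).
rewrite linear_sumlz; apply: eq_bigr => a _.
rewrite linear_sumr; apply: eq_bigr => b _.
by rewrite [in RHS]linearZl_LR [in RHS]linearZr_LR.
Qed.

Definition gram i x : 'M[R]_k :=
  \matrix_(a, b) g x (trivV i x (delta_mx 0 a)) (trivV i x (delta_mx 0 b)).

Lemma gramE i x (v : E x) b : tdom i x ->
  g x v (trivV i x (delta_mx 0 b)) = (triv i x v *m gram i x) 0 b.
Proof.
move=> xi; rewrite {1}(triv_expand v xi) linear_sumlz mxE; apply: eq_bigr => a _.
by rewrite linearZl_LR mxE.
Qed.

(** A left kernel vector of the Gram matrix is a vector orthogonal to the whole
    fiber. *)
Lemma gram_unit i x : tdom i x -> gram i x \in unitmx.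
Proof.
move=> xi; rewrite -row_free_unit -kermx_eq0; apply/eqP/row_matrixP => c.
rewrite row0; set w := row c _.
have wG : w *m gram i x = 0 by apply/sub_kermxP; exact: row_sub.
suff /(congr1 (triv i x)) : trivV i x w = 0 by rewrite trivVK// linear0.
apply: (pmetric_nondeg (p := g)) => v.
rewrite (triv_expand v xi) linear_sumr big1// => b _.
by rewrite linearZr_LR gramE// trivVK// wG mxE; exact: mulr0.
Qed.

(** The isomorphism sharp_g on global sections. The row of components w solves
    w G = phi, with G the Gram matrix and phi the values of Phi on the frame
    sections divided by the cutoff, so smoothness of w comes from that of the
    inverse of G. *)
Lemma section_riesz (Phi : section E -> M -> R) :
  (forall x, tensorial_at x (fun s => Phi s x : R^o)) ->
  (forall s, msmooth setT (Phi s)) ->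
  exists c : section E, forall s x, gdot g c s x = Phi s x.
Proof.
move=> tPhi sPhi.
have alpha_ x : exists alpha : {linear E x -> R^o}, forall s : section E, Phi s x = alpha (s x).
  exact: tensorial_linear (tPhi x).
pose alpha x := projT1 (cid (alpha_ x)).
have alphaE x (s : section E) : Phi s x = alpha x (s x) := projT2 (cid (alpha_ x)) s.
pose c x := sharp g (alpha x).
have cE (s : section E) x : g x (c x) (s x) = Phi s x by rewrite sharpP alphaE.
suff cs : smooth_section c by exists (Section cs) => s x; exact: cE.
move=> i; apply: msmooth_glue => x xi.
have [chi [U [si oU Ux Ui chi0]]] := local_cutoff xi.
exists U => //.
have hc := msmooth_inv oU chi0 (msmooth_sub (@subsetT _ U) (smooth_fun_smooth chi)).
apply: msmooth_row => // a.
have hG := msmooth_invmx oU (fun y Uy => gram_unit (Ui y Uy)) _.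
have hP b := msmooth_sub (@subsetT _ U) (sPhi (frame si (delta_mx 0 b))).
have hS := msmooth_sum (index_enum 'I_k) xpredT oU
  (fun b => msmoothM oU (msmoothM oU hc (hP b)) (hG _ b a)).
apply: (msmooth_ext oU _ (hS _)) => [y Uy|b b']; last first.
  apply: (msmooth_ext oU _ (msmooth_sub Ui (pmetric_smooth g i (delta_mx 0 b) (delta_mx 0 b')))).
  by move=> y _; rewrite mxE.
have yi := Ui y Uy.
rewrite -[triv i y (c y)](mulmxK (gram_unit yi)) [RHS]mxE; apply: eq_bigr => b _.
congr (_ * _); rewrite -gramE// -cE /= linearZr_LR /= mulrA mulVf ?mul1r//.
exact: chi0.
Qed.

Lemma gdot_inj (c c' : section E) :
  (forall s x, gdot g c s x = gdot g c' s x) -> c = c'.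
Proof.
move=> cc'; apply: sectionP => x; apply/eqP; rewrite -subr_eq0; apply/eqP.
apply: (pmetric_nondeg (p := g)) => v; have [s <-] := section_extend v.
by rewrite linearBl; apply/eqP; rewrite subr_eq0; apply/eqP; exact: cc'.
Qed.

End TensorialSections.

(** * Brackets on a pseudo-Euclidean bundle *)

Section PseudoEuclideanBrackets.
Context {R : realType} {n k : nat} {M : manifold R n} {E : vbundle M k}.
Variables (g : pseudo_metric E) (rho : bundle_morphism E (TM M)).
Implicit Types (s t u e : section E) (f : smooth_fun M).

Lemma pmetric_inj x (u w : E x) : (forall v, g x u v = g x w v) -> u = w.
Proof.
move=> uw; apply/eqP; rewrite -subr_eq0; apply/eqP.
apply: (pmetric_nondeg (p := g)) => v.
by rewrite linearBl /= uw subrr.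
Qed.

Lemma partialE x (alpha : {linear TM M x -> R^o}) v :
  g x (partial g rho alpha) v = 2^-1 * alpha (rho x v).
Proof. by rewrite /partial linearZl_LR /= sharpP. Qed.

Lemma partial_funE (h : M -> R) x v :
  g x (partial_fun g rho h x) v = 2^-1 * mdiff h x (rho x v).
Proof. exact: partialE. Qed.

Lemma gdotC s t x : gdot g s t x = gdot g t s x.
Proof. exact: pmetric_sym. Qed.

Lemma gdotDl s t u x : gdot g (s + t) u x = gdot g s u x + gdot g t u x.
Proof. exact: linearDl. Qed.

Lemma gdotDr s t u x : gdot g s (t + u) x = gdot g s t x + gdot g s u x.
Proof. exact: linearDr. Qed.

Lemma gdotNl s t x : gdot g (- s) t x = - gdot g s t x.
Proof. by rewrite /gdot sectionNE linearNl. Qed.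

Lemma gdotZl (f : smooth_fun M) s t x : gdot g (fscale f s) t x = f x * gdot g s t x.
Proof. by rewrite /gdot /= linearZl_LR. Qed.

Lemma gdotZr (f : smooth_fun M) s t x : gdot g s (fscale f t) x = f x * gdot g s t x.
Proof. by rewrite gdotC gdotZl gdotC. Qed.

Lemma bmapD s t : bmap rho (s + t) = bmap rho s + bmap rho t.
Proof. by apply: sectionP => x /=; rewrite linearD. Qed.

Lemma bmap_fscale f s : bmap rho (fscale f s) = fscale f (bmap rho s).
Proof. by apply: sectionP => x /=; rewrite linearZ. Qed.

(** The two symmetries generate a cyclic symmetry of g(D(s, t), u), which moves
    any argument into the slot of the metric, where function-linearity is
    automatic. *)
Lemma skew_tensorial (D : section E -> section E -> section E) :
  (forall s t, D s t = - D t s) ->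
  (forall s t u x, gdot g (D s t) u x = - gdot g (D s u) t x) ->
  forall t x, tensorial_at x (fun s => D s t x) /\ tensorial_at x (fun s => D t s x).
Proof.
move=> Dskew gskew.
have cyc s t u x : gdot g (D s t) u x = gdot g (D t u) s x.
  by rewrite gskew Dskew gdotNl opprK gskew Dskew gdotNl opprK.
have DD s s' t : D (s + s') t = D s t + D s' t.
  apply: (gdot_inj (g := g)) => u x.
  by rewrite gdotDl (cyc (s + s') t u) (cyc s t u) (cyc s' t u) gdotDr.
have DZ f s t : D (fscale f s) t = fscale f (D s t).
  apply: (gdot_inj (g := g)) => u x.
  by rewrite gdotZl (cyc (fscale f s) t u) (cyc s t u) gdotZr.
move=> t x; split; split.
- by move=> s s'; rewrite DD.
- by move=> f s; rewrite DZ.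
- by move=> s s'; rewrite Dskew DD sectionNE opprD -!sectionNE -!Dskew.
by move=> f s; rewrite Dskew DZ sectionNE /= -scalerN -sectionNE -Dskew.
Qed.

(** All terms in which the bracket does not occur are gathered on the right, so that
    two brackets satisfying the property can be compared. *)
Lemma metric_invariantE br : metric_invariant g rho br <->
  forall e s t x, gdot g (br e s) t x + gdot g (br e t) s x =
    mdiff (gdot g s t) x (rho x (e x))
    - 2^-1 * (mdiff (gdot g e s) x (rho x (t x)) + mdiff (gdot g e t) x (rho x (s x))).
Proof.
have E1 e s t x : g x (br e s x + partial_fun g rho (gdot g e s) x) (t x) =
    gdot g (br e s) t x + 2^-1 * mdiff (gdot g e s) x (rho x (t x)).
  by rewrite linearDl partial_funE.
have E2 e s t x : g x (s x) (br e t x + partial_fun g rho (gdot g e t) x) =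
    gdot g (br e t) s x + 2^-1 * mdiff (gdot g e t) x (rho x (s x)).
  by rewrite pmetric_sym; exact: E1.
split=> h e s t x; have := h e s t x; rewrite (E1 e s t x) (E2 e s t x).
  by move=> ->; ring.
by move/eqP; rewrite eq_sym subr_eq => /eqP ->; ring.
Qed.

Lemma gdot_aform (beta : alt_form E) s t u x :
  gdot g (aform_section beta s t) u x = g x (beta x (s x) (t x)) (u x).
Proof. by []. Qed.

Lemma aform_skew (beta : alt_form E) x (u v : E x) : beta x u v = - beta x v u.
Proof.
apply/eqP; rewrite -addr_eq0; apply/eqP.
have := aform_alt beta (u + v).
by rewrite linearDl !linearDr !aform_alt add0r addr0.
Qed.

(** In (v) the two contributions of beta, g(beta(e, s), t) and g(s, beta(e, t)),
    cancel by skewness in the last two arguments. *)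
Lemma bracket_shift br (beta : alt_form E) :
  skew_bracket br -> metric_invariant g rho br -> totally_skew g beta ->
  let br' s t := br s t - aform_section beta s t in
  skew_bracket br' /\ metric_invariant g rho br'.
Proof.
move=> [[lin1 lin2] sk] /metric_invariantE inv tsk br'; split; last first.
  apply/metric_invariantE => e s t x; rewrite -inv /br' !gdotDl !gdotNl !gdot_aform.
  by rewrite (tsk x (e x) (s x) (t x)).2; ring.
have linl t : linear (br'^~ t).
  move=> a s s'; apply: sectionP => x.
  have /(congr1 (fun s : section E => s x)) := lin1 t a s s'.
  rewrite /br' !(sectionDE, sectionNE, sectionZE) /= => ->.
  by rewrite linearPl /= opprD addrACA scalerBr.
have skw s t : br' s t = - br' t s.
  apply: sectionP => x; rewrite sectionNE /br' sk !sectionBE sectionNE /=.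
  by rewrite aform_skew opprB opprK addrC.
split; last exact: skw.
split=> [t|s] a u v; first exact: linl.
by rewrite skw linl opprD -scalerN -!skw.
Qed.

(** The terms of (v) without bracket are the same for both brackets, so the
    difference D satisfies g(D(e, s), t) = - g(D(e, t), s). *)
Lemma bracket_difference br1 br2 :
  skew_bracket br1 -> metric_invariant g rho br1 ->
  skew_bracket br2 -> metric_invariant g rho br2 ->
  exists beta : alt_form E, totally_skew g beta /\
    forall s t, br2 s t = br1 s t - aform_section beta s t.
Proof.
move=> [_ sk1] /metric_invariantE inv1 [_ sk2] /metric_invariantE inv2.
pose D s t := br1 s t - br2 s t.
have Dskew s t : D s t = - D t s by rewrite /D sk1 sk2 opprB opprK addrC.
have gskew s t u x : gdot g (D s t) u x = - gdot g (D s u) t x.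
  apply/eqP; rewrite -addr_eq0 /D !gdotDl !gdotNl addrACA -opprD inv1 inv2.
  by rewrite subrr.
have tD := skew_tensorial Dskew gskew.
have Dalt s : D s s = 0.
  apply: (gdot_inj (g := g)) => u x; have := gdotNl (D s s) u x.
  rewrite -Dskew => h; rewrite /gdot linear0l -/(gdot g (D s s) u x); lra.
have [beta betaE] := alt_form_of_tensor (fun t x => (tD t x).1) (fun s x => (tD s x).2) Dalt.
exists beta; split=> [x u v w|s t]; last by rewrite betaE /D subKr.
have [s <-] := section_extend u; have [t <-] := section_extend v.
have [r <-] := section_extend w.
by rewrite -!gdot_aform !betaE; split; [rewrite Dskew gdotNl|exact: gskew].
Qed.

Section Nabla.
Variable nabla : connection E.

Lemma nablaZ (a : R) X s : nabla X (a *: s) = a *: nabla X s.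
Proof.
apply: sectionP => x; rewrite -[a *: s]/(fscale (cst_fun a) s) nabla_leibniz.
by rewrite mdiff_cst scale0r addr0.
Qed.

Lemma gamma_unique s t c c' :
  gamma_eq g rho nabla s t c -> gamma_eq g rho nabla s t c' -> c = c'.
Proof. by move=> h h'; apply: (gdot_inj (g := g)) => e x; rewrite h h'. Qed.

(** The right-hand side is tensorial in e because nabla is so in its direction
    argument. *)
Lemma gamma_exists s t : exists c, gamma_eq g rho nabla s t c.
Proof.
apply: section_riesz => [x|e]; last first.
  have a := gdot_smooth g s (nabla (bmap rho e) t).
  have b := gdot_smooth g t (nabla (bmap rho e) s).
  have h := msmoothM openT (msmooth_cst _ (2^-1 : R))
    (msmoothD openT a (msmoothM openT (msmooth_cst _ (-1 : R)) b)).
  by apply: (msmooth_ext openT _ h) => y _; rewrite /= mulN1r.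
split=> [e e'|f e].
  by rewrite bmapD !nablaDl !gdotDr; ring.
by rewrite bmap_fscale !nablaMl !gdotZr /GRing.scale /=; ring.
Qed.

Variable gamma : section E -> section E -> section E.
Hypothesis gammaE : forall s t, gamma_eq g rho nabla s t (gamma s t).

Lemma gamma_skew s t : gamma s t = - gamma t s.
Proof. by apply: (gdot_inj (g := g)) => e x; rewrite gdotNl !gammaE; ring. Qed.

Lemma gamma_linearl t : linear (gamma^~ t).
Proof.
move=> a s s'; apply: (gdot_inj (g := g)) => e x.
rewrite gdotDl (gdotZl (cst_fun a)) !gammaE nablaDr nablaZ gdotDl gdotDr.
by rewrite (gdotZl (cst_fun a)) (gdotZr (cst_fun a)) /=; ring.
Qed.

(** The extra term comes from the Leibniz rule for nabla_(rho e) (f s), the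
    derivative (rho e) f being 2 g(partial f, e). *)
Lemma gamma_fscale f s t x :
  gamma (fscale f s) t x = f x *: gamma s t x - gdot g s t x *: partial_fun g rho f x.
Proof.
apply: pmetric_inj => v; have [e <-] := section_extend v.
rewrite linearBl 2!linearZl_LR partial_funE.
rewrite -/(gdot g (gamma (fscale f s) t) e x) -/(gdot g (gamma s t) e x).
rewrite !gammaE gdotZl.
have -> : gdot g t (nabla (bmap rho e) (fscale f s)) x =
    f x * gdot g t (nabla (bmap rho e) s) x
    + (mdiff f x (rho x (e x)) : R) * gdot g t s x.
  by rewrite /gdot nabla_leibniz linearDr !linearZr_LR.
by rewrite (gdotC s t) /GRing.scale /=; ring.
Qed.

Local Notation br0 := (bracket0 rho nabla gamma).

Lemma bracket0_skew s t : br0 s t = - br0 t s.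
Proof. by rewrite /bracket0 (gamma_skew t s) !opprB addrC. Qed.

Lemma bracket0_skew_bracket : skew_bracket br0.
Proof.
have linl t : linear (br0^~ t).
  move=> a s s'; rewrite /bracket0 nablaDr nablaZ gamma_linearl.
  have -> : nabla (bmap rho (a *: s + s')) t =
      a *: nabla (bmap rho s) t + nabla (bmap rho s') t.
    by rewrite bmapD nablaDl; congr (_ + _); rewrite (bmap_fscale (cst_fun a)) nablaMl.
  by rewrite !scalerBr opprD addrACA opprD [LHS]addrACA.
split; last exact: bracket0_skew.
split=> [t|s] a u v; first exact: linl.
by rewrite bracket0_skew linl opprD -scalerN -!bracket0_skew.
Qed.

Hypothesis nabla_metric : metric_connection g nabla.

Lemma gdot_bracket0 s t u x :
  gdot g (br0 s t) u x =
    gdot g (nabla (bmap rho s) t) u x - gdot g (nabla (bmap rho t) s) u x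
    - 2^-1 * (gdot g s (nabla (bmap rho u) t) x - gdot g t (nabla (bmap rho u) s) x).
Proof. by rewrite /bracket0 !gdotDl !gdotNl gammaE. Qed.

(** Metricity turns the derivatives in (v) into terms g(nabla_(rho u) v, w). The
    symmetric combination coming from partial g(e, s) completes the
    antisymmetric one coming from gamma(e, s), and the terms that are left
    cancel against those in which s and t are exchanged. *)
Lemma bracket0_metric_invariant : metric_invariant g rho br0.
Proof.
move=> e s t x.
have inv e1 e2 : g x (br0 e e1 x + partial_fun g rho (gdot g e e1) x) (e2 x) =
    gdot g (br0 e e1) e2 x
    + 2^-1 * (gdot g (nabla (bmap rho e2) e) e1 x + gdot g e (nabla (bmap rho e2) e1) x).
  have dm : mdiff (gdot g e e1) x (rho x (e2 x)) = _ :=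
    nabla_metric (bmap rho e2) e e1 x.
  by rewrite linearDl partial_funE dm.
rewrite inv pmetric_sym inv !gdot_bracket0.
have -> : mdiff (gdot g s t) x (rho x (e x)) =
    gdot g (nabla (bmap rho e) s) t x + gdot g s (nabla (bmap rho e) t) x.
  exact: nabla_metric (bmap rho e) s t x.
(* Orient every product so that nabla stands in its left factor. *)
rewrite (gdotC s (nabla (bmap rho e) t)) (gdotC (nabla (bmap rho s) e) t).
rewrite ?(gdotC s) ?(gdotC t) ?(gdotC e).
by field.
Qed.

(** The terms (rho t) f rho s coming from nabla and from the Lie bracket cancel. *)
Lemma rho_torsion_fscalel f s t x :
  rho_torsion rho nabla (fscale f s) t x = f x *: rho_torsion rho nabla s t x.
Proof.
have aux (V : lmodType R) (a b : R) (p q r w : V) :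
    a *: p - (a *: q + b *: r) - (a *: w - b *: r) = a *: (p - q - w).
  by rewrite !scalerBr !opprD opprK !addrA [LHS]addrAC subrK.
have e1 : rho x ((nabla (bmap rho (fscale f s)) t - nabla (bmap rho t) (fscale f s)) x) =
    f x *: rho x (nabla (bmap rho s) t x)
    - (f x *: rho x (nabla (bmap rho t) s x)
       + (mdiff f x (bmap rho t x) : R) *: rho x (s x)).
  by rewrite bmap_fscale nablaMl sectionBE nabla_leibniz linearB linearD !linearZ.
have e2 := lie_fscalel f (bmap rho s) (bmap rho t) x.
rewrite bmap_fscale in e1; rewrite /rho_torsion bmap_fscale.
apply: etrans (congr2 (fun p q => p - q) e1 e2) _.
by rewrite sectionBE (linearB (rho x)); exact: aux.
Qed.

(** gamma(s, t) is the image under partial of the covector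
    X |-> g(s, nabla_X t) - g(t, nabla_X s); the factor 1/2 in the definition of
    gamma is the one in the definition of partial. *)
Lemma rho_gamma0 : rho_partial0 g rho -> forall s t x, rho x (gamma s t x) = 0.
Proof.
move=> rp0 s t x.
have [alpha alphaE] : exists alpha : {linear TM M x -> R^o}, forall X : section (TM M),
    gdot g s (nabla X t) x - gdot g t (nabla X s) x = alpha (X x).
  apply: (@tensorial_linear _ _ _ _ (TM M) R^o x
    (fun X => gdot g s (nabla X t) x - gdot g t (nabla X s) x)).
  split=> [X Y|f X]; first by rewrite !nablaDl !gdotDr; ring.
  by rewrite !nablaMl !gdotZr /GRing.scale /=; ring.
suff -> : gamma s t x = partial g rho alpha by exact: rp0.
apply: pmetric_inj => v; have [e <-] := section_extend v.
by rewrite partialE -(alphaE (bmap rho e)); exact: gammaE.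
Qed.

Lemma rho_bracket0 s t x :
  bmap rho (br0 s t) x =
  lie (bmap rho s) (bmap rho t) x + (rho_torsion rho nabla s t x - rho x (gamma s t x)).
Proof.
have aux (V : zmodType) (a b c : V) : a - c = b + (a - b - c).
  by rewrite addrA [b + _]addrC subrK.
have e : br0 s t x = (nabla (bmap rho s) t - nabla (bmap rho t) s) x - gamma s t x.
  exact: sectionBE.
apply: etrans (congr1 (rho x) e) _.
exact: etrans (linearB (rho x) _ _) (aux _ _ _ _).
Qed.

Lemma anchor_preservesE (beta : alt_form E) :
  anchor_preserves rho (fun s t => br0 s t - aform_section beta s t) <->
  forall s t x,
    rho_torsion rho nabla s t x =
    rho x (gamma s t x) + rho x (aform_section beta s t x).
Proof.
have E1 s t x : bmap rho (br0 s t - aform_section beta s t) x =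
    lie (bmap rho s) (bmap rho t) x + (rho_torsion rho nabla s t x -
      (rho x (gamma s t x) + rho x (aform_section beta s t x))).
  have aux (V : zmodType) (a b c d : V) : a + (b - c) - d = a + (b - (c + d)).
    by rewrite opprD !addrA.
  have e : (br0 s t - aform_section beta s t) x = br0 s t x - aform_section beta s t x.
    exact: sectionBE.
  apply: etrans (congr1 (rho x) e) _.
  apply: etrans (linearB (rho x) _ _) _.
  by rewrite -aux; congr (_ - _); exact: rho_bracket0.
split=> h s t x.
  have := h s t x; rewrite E1 -[RHS]addr0 => /addrI/eqP.
  by rewrite subr_eq0 => /eqP.
by rewrite E1 h subrr addr0.
Qed.

(** Comparing the identity of [anchor_preservesE] at (f s, t) with f times the
    one at (s, t) leaves g(s, t) rho (partial f) = 0. If partial f is nonzero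
    at x, nondegeneracy provides t with g(s, t) nonzero at x for s extending
    partial f; if it is zero, as on a bundle of rank 0, so is its image. *)
Lemma anchor_rho_partial0 (beta : alt_form E) :
  anchor_preserves rho (fun s t => br0 s t - aform_section beta s t) ->
  rho_partial0 g rho.
Proof.
move=> /anchor_preservesE h x alpha.
have [u0|] := eqVneq (partial g rho alpha) 0; first by rewrite u0 linear0.
have [f fE] := mdiff_surjective alpha.
have fp : partial_fun g rho f x = partial g rho alpha.
  by apply: pmetric_inj => v; rewrite partial_funE partialE fE.
rewrite -fp => p0.
have [s sx] := section_extend (partial_fun g rho f x).
have [v v0] : exists v, g x (s x) v != 0.
  apply: contrapT => no; move/eqP: p0; apply; rewrite -sx.
  apply: (pmetric_nondeg (p := g)) => v; apply: contrapT => /eqP v0.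
  by apply: no; exists v.
have [t tv] := section_extend v.
have eg : rho x (gamma (fscale f s) t x) =
    f x *: rho x (gamma s t x) - gdot g s t x *: rho x (partial_fun g rho f x).
  by rewrite gamma_fscale (linearB (rho x)) !linearZ.
have eb : rho x (aform_section beta (fscale f s) t x) =
    f x *: rho x (aform_section beta s t x).
  by rewrite /= linearZl_LR linearZ.
have aux (V : lmodType R) (a b : R) (p q r : V) :
    a *: (p + q) = a *: p - b *: r + a *: q -> b *: r = 0.
  rewrite scalerDr addrAC => /eqP; rewrite eq_sym subr_eq -subr_eq0.
  by rewrite opprD addNKr oppr_eq0 => /eqP.
have /aux/eqP : f x *: (rho x (gamma s t x) + rho x (aform_section beta s t x)) =
    f x *: rho x (gamma s t x) - gdot g s t x *: rho x (partial_fun g rho f x)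
    + f x *: rho x (aform_section beta s t x).
  by rewrite -h -rho_torsion_fscalel h eg eb.
rewrite scaler_eq0 => /orP[|/eqP//].
by rewrite /gdot tv (negPf v0).
Qed.

End Nabla.
End PseudoEuclideanBrackets.

Theorem proposition2p1 (R : realType) (n k : nat) (M : manifold R n)
    (E : vbundle M k) (g : pseudo_metric E) (rho : bundle_morphism E (TM M))
    (nabla : connection E) (nabla_metric : metric_connection g nabla) :
  (forall e1 e2 : section E, exists! c : section E, gamma_eq g rho nabla e1 e2 c) /\
  forall gamma : section E -> section E -> section E,
  (forall e1 e2 : section E, gamma_eq g rho nabla e1 e2 (gamma e1 e2)) ->
  let br0 := bracket0 rho nabla gamma in
  (* 1 *)
  (skew_bracket br0 /\ metric_invariant g rho br0) /\
  (* 2 *)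
  (forall br : section E -> section E -> section E,
     (skew_bracket br /\ metric_invariant g rho br) <->
     exists beta : alt_form E, totally_skew g beta /\
       forall e1 e2 : section E, br e1 e2 = br0 e1 e2 - aform_section beta e1 e2) /\
  (* 3 *)
  (forall beta : alt_form E, totally_skew g beta ->
     (anchor_preserves rho (fun e1 e2 => br0 e1 e2 - aform_section beta e1 e2) <->
      rho_partial0 g rho /\
      forall (e1 e2 : section E) (x : M),
        rho x (aform_section beta e1 e2 x) = rho_torsion rho nabla e1 e2 x)) /\
  (rho_partial0 g rho ->
   (forall (e1 e2 : section E) (x : M), rho_torsion rho nabla e1 e2 x = 0) ->
   anchor_preserves rho br0).
Proof.
split=> [s t|gamma gammaE br0].
  have [c cP] := gamma_exists g rho nabla s t.
  by exists c; split=> // c'; exact: gamma_unique cP.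
have sk0 : skew_bracket br0 := bracket0_skew_bracket gammaE.
have inv0 : metric_invariant g rho br0 := bracket0_metric_invariant gammaE nabla_metric.
have part3 (beta : alt_form E) : totally_skew g beta ->
    (anchor_preserves rho (fun e1 e2 => br0 e1 e2 - aform_section beta e1 e2) <->
     rho_partial0 g rho /\
     forall (e1 e2 : section E) (x : M),
       rho x (aform_section beta e1 e2 x) = rho_torsion rho nabla e1 e2 x).
  move=> _; split=> [anc|[rp0 betaT]].
    have rp0 := anchor_rho_partial0 gammaE anc.
    split=> // s t x; have /anchor_preservesE -> := anc.
    by rewrite (rho_gamma0 gammaE rp0) add0r.
  apply/anchor_preservesE => s t x.
  by rewrite (rho_gamma0 gammaE rp0) add0r betaT.
split; first by split.
split=> [br|].
  split=> [[sk inv]|[beta [tsk brE]]]; first exact: bracket_difference.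
  have -> : br = fun s t => br0 s t - aform_section beta s t.
    by apply/funext => s; apply/funext => t; exact: brE.
  exact: bracket_shift.
split=> // rp0 T0 s t x.
by rewrite rho_bracket0 T0 (rho_gamma0 gammaE rp0) subrr addr0.
Qed.
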